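(* Let $1\le k<n$ be integers, let $\xi_1,\ldots,\xi_n$ be independent standard normal random variables, let $|\xi|_{(1)}\le\ldots\le|\xi|_{(n)}$ be the order statistics of $|\xi_1|,\ldots,|\xi_n|$, and for $\varepsilon>0$ let $B_{n,k}(\varepsilon)=\{|\xi|_{(n)}-|\xi|_{(n-k+1)}\le\varepsilon\}$. Let $C^{n}=\mathrm{conv}[\pm e_1,\ldots,\pm e_n]$, where $e_1,\ldots,e_n$ is the standard orthonormal basis of $\mathbb R^n$. Then the $k$-th intrinsic volume of $C^n$ satisfies $$V_k(C^{n})=\frac{(2\pi)^{k/2}}{k!}\cdot\lim_{\varepsilon\downarrow0}\varepsilon^{1-k}\,\mathbb E\big[\max\{|\xi_1|,\ldots,|\xi_n|\}\,\mathbf 1_{B_{n,k}(\varepsilon)}\big].$$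
   Context: $\mathrm{conv}$ denotes the convex hull and $\mathbf 1_A$ the indicator of an event $A$. For a compact convex set $T\subset\mathbb R^n$ the intrinsic volumes $V_0(T),\ldots,V_n(T)$ are defined by the Steiner formula $\mathrm{Vol}_n(T+r\mathbb B_n)=\sum_{k=0}^n\kappa_{n-k}V_k(T)r^{n-k}$ for all $r\ge0$, where $\mathbb B_n$ is the unit ball of $\mathbb R^n$ and $\kappa_k=\pi^{k/2}/\Gamma(\frac k2+1)$. *)

(* Defs.v *)
From HB Require Import structures.
From mathcomp Require Import all_boot all_order all_algebra.
From mathcomp Require Import all_classical all_reals all_analysis.

Set Implicit Arguments.
Unset Strict Implicit.
Unset Printing Implicit Defensive.

Import Order.TTheory GRing.Theory Num.Theory.
Import numFieldNormedType.Exports.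

Local Open Scope classical_set_scope.
Local Open Scope ring_scope.

Section lebesgue_tuple_step.
Context {R : realType} (n : nat).
Local Notation RR := (measurableTypeR R).
Variable m : {sigma_finite_measure set (n.-tuple RR) -> \bar R}.

Definition cons_pair (p : RR * n.-tuple RR) : n.+1.-tuple RR :=
  [tuple of p.1 :: p.2].

Lemma measurable_cons_pair : measurable_fun [set: _] cons_pair.
Proof. exact: measurable_cons. Qed.

Definition lebesgue_cons : set (n.+1.-tuple RR) -> \bar R :=
  pushforward (@lebesgue_measure R \x m)%E cons_pair.

Let lebesgue_cons0 : lebesgue_cons set0 = 0%E.
Proof. by rewrite /lebesgue_cons /pushforward preimage_set0 measure0. Qed.

Let lebesgue_cons_ge0 A : (0 <= lebesgue_cons A)%E.
Proof. by apply: integral_ge0 => // *. Qed.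

Let lebesgue_cons_sigma_additive : semi_sigma_additive lebesgue_cons.
Proof.
move=> F mF tF mUF; rewrite /lebesgue_cons /pushforward preimage_bigcup.
apply: measure_semi_sigma_additive.
- by move=> i; rewrite -[X in measurable X]setTI; exact: measurable_cons_pair.
- apply/trivIsetP => /= i j _ _ ij; rewrite -preimage_setI.
  by move/trivIsetP : tF => /(_ _ _ _ _ ij) ->//; rewrite preimage_set0.
- rewrite -preimage_bigcup -[X in measurable X]setTI.
  exact: measurable_cons_pair.
Qed.

HB.instance Definition _ := isMeasure.Build _ _ _ lebesgue_cons
  lebesgue_cons0 lebesgue_cons_ge0 lebesgue_cons_sigma_additive.

Let lebesgue_cons_sigma_finite : sigma_finite setT lebesgue_cons.
Proof.
have /sigma_finiteP[F [TF ndF Foo]] := sigma_finiteT (@lebesgue_measure R).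
have /sigma_finiteP[G [TG ndG Goo]] := sigma_finiteT m.
pose u (t : n.+1.-tuple RR) : RR * n.-tuple RR := (thead t, [tuple of behead t]).
have mu_ : measurable_fun [set: _] u.
  apply/measurable_fun_pairP; split => /=.
    rewrite (_ : fst \o u = (@tnth _ RR ^~ ord0)); first exact: measurable_tnth.
    by apply/funext => t.
  exact: measurable_behead.
exists (fun i => u @^-1` (F i `*` G i)).
  rewrite -preimage_bigcup -(preimage_setT u); congr (u @^-1` _).
  rewrite -setXTT TF TG predeqE => -[x y]; split.
    move=> [/= [k _ Fkx] [j _ Gjy]]; exists (maxn k j) => //=; split.
    - by move: x Fkx; exact/subsetPset/ndF/leq_maxl.
    - by move: y Gjy; exact/subsetPset/ndG/leq_maxr.
  by move=> [k _ [? ?]]; split; exists k.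
move=> i; have [mF Fi] := Foo i; have [mG Gi] := Goo i; split.
  by rewrite -[X in measurable X]setTI; apply: mu_ => //; exact: measurableX.
rewrite /lebesgue_cons /pushforward (_ : cons_pair @^-1` _ = F i `*` G i).
  by rewrite product_measure1E// lte_mul_pinfty// ge0_fin_numE.
rewrite -comp_preimage (_ : u \o cons_pair = id)// funeqE => -[x t].
by congr pair; exact/val_inj.
Qed.

HB.instance Definition _ := Measure_isSigmaFinite.Build _ _ _
  lebesgue_cons lebesgue_cons_sigma_finite.

End lebesgue_tuple_step.

Fixpoint lebesgue_tuple (R : realType) (n : nat) :
    {sigma_finite_measure set (n.-tuple (measurableTypeR R)) -> \bar R} :=
  match n with
  | 0 => \d_([tuple] : 0.-tuple (measurableTypeR R))
  | n'.+1 => lebesgue_cons (lebesgue_tuple R n')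
  end.

Lemma lebesgue_tuple_box (R : realType) (n : nat)
    (A : 'I_n -> set (measurableTypeR R)) :
  (forall i, measurable (A i)) ->
  lebesgue_tuple R n [set t | forall i, A i (tnth t i)] =
  (\prod_(i < n) lebesgue_measure (A i))%E.
Proof.
elim: n A => [|n IH] A mA.
  by rewrite big_ord0 /= diracE mem_set// => -[].
have mbox : measurable [set t : n.-tuple (measurableTypeR R) |
    forall i, A (lift ord0 i) (tnth t i)].
  rewrite (_ : [set _ | _] =
      \bigcap_(i in [set: 'I_n]) ((@tnth _ _ ^~ i) @^-1` A (lift ord0 i))).
    apply: fin_bigcap_measurable => // i _.
    by rewrite -[X in measurable X]setTI; exact: measurable_tnth.
  by apply/seteqP; split => [t tA i _|t tA i]; exact: tA.
rewrite big_ord_recl -IH// -product_measure1E//=.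
rewrite /lebesgue_cons /pushforward; congr (_ _).
apply/seteqP; split => -[x t] /=.
  move=> xtA; split=> [|i]; first exact: (xtA ord0).
  by have := xtA (lift ord0 i); rewrite tnthS.
by move=> [xA tA] i; case: (unliftP ord0 i) => [j|] ->; rewrite ?tnthS.
Qed.

Section convex_geometry.
Context {R : realType} {n : nat}.
Implicit Types (A T : set 'rV[R]_n) (v : 'rV[R]_n).

Definition volume A : \bar R :=
  lebesgue_tuple R n [set t | A (\row_i tnth t i)].

(* The canonical norm of ['rV[R]_n] is the sup norm. *)
Definition euclidean_norm v : R := Num.sqrt (\sum_(i < n) v 0 i ^+ 2).

Definition unit_ball : set 'rV[R]_n := [set v | euclidean_norm v <= 1].

Definition convex_hull A : set 'rV[R]_n := smallest (@convex_set R 'rV[R]_n) A.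

(* Euler's integral, meaningful for [0 < x]. *)
Definition Gamma (x : R) : R :=
  \int[@lebesgue_measure R]_(t in `]0, +oo[) (t `^ (x - 1) * expR (- t)).

Definition ball_volume (k : nat) : R :=
  pi `^ (k%:R / 2) / Gamma (k%:R / 2 + 1).

Definition steiner_formula T (V : nat -> R) :=
  forall r : R, 0 <= r ->
    volume [set x + r *: y | x in T & y in unit_ball] =
    (\sum_(k < n.+1) ball_volume (n - k) * V k * r ^+ (n - k))%:E.

(* The Steiner formula determines [V k] only for [k <= n]. The default value 0
   is used only for sets that have no Steiner polynomial. *)
Definition intrinsic_volume (k : nat) T : R :=
  xget (fun=> 0) [set V | steiner_formula T V] k.

Definition cross_polytope : set 'rV[R]_n :=
  convex_hull [set v | exists i : 'I_n, v = delta_mx 0 i \/ v = - delta_mx 0 i].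

End convex_geometry.

Arguments cross_polytope : clear implicits.

(* [order_stat x j] is the [j]-th smallest value of [x], counted from 1 with
   multiplicity. *)
Definition order_stat (R : realType) (n : nat) (x : 'I_n -> R) (j : nat) : R :=
  nth 0 (sort <=%R [seq x i | i <- enum 'I_n]) j.-1.

Section random_variables.
Context {d : measure_display} {Omega : measurableType d} {R : realType}.
Variables (P : probability Omega R) (n : nat) (xi : 'I_n -> {RV P >-> R}).

Definition independent_RVs :=
  forall (J : {set 'I_n}) (A : 'I_n -> set R), (forall i, measurable (A i)) ->
    P (\bigcap_(i in [set` J]) (xi i @^-1` A i)) =
    (\prod_(i in J) P (xi i @^-1` A i))%E.

(* Set functions are constrained on measurable sets only, so the laws are
   compared there. *)
Definition standard_normal (X : {RV P >-> R}) :=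
  forall A : set R, measurable A -> distribution P X A = normal_prob 0 1 A.

(* The default 0 is neutral here, all the terms being nonnegative. *)
Definition max_abs (w : Omega) : R := \big[Num.max/0]_(i < n) `|xi i w|.

Definition top_gap_event (k : nat) (eps : R) : set Omega :=
  [set w | order_stat (fun i => `|xi i w|) n
           - order_stat (fun i => `|xi i w|) (n - k + 1) <= eps].

End random_variables.

(* Main.v *)
Require Import Defs.
From HB Require Import structures.
From mathcomp Require Import all_boot all_order all_algebra.
From mathcomp Require Import all_classical all_reals all_analysis.
From mathcomp Require Import measurable_realfun ring lra.

Import Order.TTheory GRing.Theory Num.Theory.
Import numFieldNormedType.Exports.

Local Open Scope classical_set_scope.
Local Open Scope ring_scope.

Set Implicit Arguments.
Unset Strict Implicit.
Unset Printing Implicit Defensive.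

(* The point of the cross-polytope [C] nearest to [x] is the soft thresholding
   of [x] at the level [s >= 0] with [\sum_i max (|x_i| - s) 0 = 1] ([s = 0]
   inside [C]), and the squared distance is [\sum_i min |x_i| s ^ 2]. The points
   projecting to the relative interior of a [k]-face are those with [k + 1]
   coordinates exceeding [s]. Trading one of these coordinates for [s] is an
   affine change of variables with slope [k + 1], after which the remaining
   integral factors: the exceeding coordinates contribute the volume of a
   simplex, the others a set which scales like [r ^ (n - k)], and integrating it
   against [r e^(- r^2 / 2)] turns its volume into the one-dimensional integral
   [I = \int_0^oo e^(- (k + 1) s^2 / 2) (\int_0^s e^(- x^2 / 2) dx)^(n - k - 1) ds].
   This gives the Steiner polynomial of [C], hence [V_k(C)] as a multiple of [I].

   On the Gaussian side, conditioning on the index and the value [x] of the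
   largest coordinate, the expectation is an integral over [x] of the
   probability that at least [k - 1] other coordinates lie in [[x - eps, x]] and
   the others below. Dividing by [eps ^ (k - 1)] and using dominated convergence,
   the limit is a multiple of
   [\int_0^oo x e^(- k x^2 / 2) (\int_0^x e^(- y^2 / 2) dy)^(n - k) dx], and an
   integration by parts turns it into a multiple of [I]. *)

(** * Measures on tuples *)

(** The volume that scales like [r ^ (n - k)] is never evaluated. Only its finiteness and
    homogeneity matter: integrating it against [e^(- u)], with [u = r ^ 2 / 2], produces the factor
    [Gamma ((n - k) / 2 + 1)] which also occurs in [ball_volume (n - k)], and the quotient leaves a
    power of [2 * pi].

    Two degeneracies shape the proof. Along a line parallel to an axis, the thresholds of the points
    of one piece could a priori form any set; the change of variables works because the same
    coordinates exceed all of them, so that one affine map covers the whole fibre. On the Gaussian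
    side the index of the maximum may be ambiguous; the payoff is squeezed between sums over strict
    and over weak maxima, whose integrals coincide because [|x| < a] and [|x| <= a] have the same
    normal mass.

    Regions are kept as nonnegative indicators, so that every exchange of integrals, integration by
    parts included, is an instance of Tonelli's theorem. *)

Section tuple_measures.
Context {R : realType}.
Local Notation RR := (measurableTypeR R).
Implicit Types n : nat.

Definition centered_itv (k : nat) : set RR := `[- (k%:R : R), k%:R]%classic.

Definition box n (A : 'I_n -> set RR) : set (n.-tuple RR) :=
  [set t | forall i, A i (tnth t i)].

Lemma measurable_box n (A : 'I_n -> set RR) :
  (forall i, measurable (A i)) -> measurable (box A).
Proof.
move=> mA; rewrite (_ : box A =
    \bigcap_(i in [set: 'I_n]) ((@tnth _ _ ^~ i) @^-1` A i)).
  apply: fin_bigcap_measurable => // i _.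
  by rewrite -[X in measurable X]setTI; exact: measurable_tnth.
by apply/seteqP; split => [t tA i _|t tA i]; exact: tA.
Qed.

(** Boxes are stable under intersection and generate the sigma-algebra, and the cubes with sides
    [centered_itv k] exhaust the space with finite measure. *)
Lemma measure_tuple_unique n (m1 m2 : {measure set (n.-tuple RR) -> \bar R}) :
  (forall A, (forall i, measurable (A i)) -> m1 (box A) = m2 (box A)) ->
  (forall k : nat, m1 (box (fun=> centered_itv k)) < +oo)%E ->
  forall A, measurable A -> m1 A = m2 A.
Proof.
move=> m12 m1oo.
pose G := [set B | exists2 A : 'I_n -> set RR,
  (forall i, measurable (A i)) & B = box A].
apply: (measure_unique G (fun k => box (fun=> centered_itv k))) => //.
- apply/seteqP; split; last first.
    by apply: smallest_sub; [exact: sigma_algebra_measurable|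
      move=> _ [A mA ->]; exact: measurable_box].
  apply: smallest_sub; first exact: smallest_sigma_algebra.
  move=> B; rewrite -bigcup_seq => -[i _ [A mA <-]].
  apply: sub_gen_smallest.
  exists (fun j => if j == i then A else setT).
    by move=> j; case: ifP.
  rewrite setTI; apply/seteqP; split => t /=; last by move=> /(_ i); rewrite eqxx.
  by move=> tA j; case: eqP => // ->.
- move=> _ _ [A mA ->] [B mB ->]; exists (fun i => A i `&` B i).
    by move=> i; exact: measurableI.
  apply/seteqP; split => t /=; first by move=> [tA tB] i; split.
  by move=> tAB; split => i; have [] := tAB i.
- by move=> k; exists (fun=> centered_itv k) => // _; exact: measurable_itv.
- apply/seteqP; split => // t _.
  exists (Num.truncn (\sum_i `|tnth t i|)).+1 => // i /=.
  rewrite /centered_itv /= in_itv/= -ler_norml (le_trans _ (ltW (truncnS_gt _)))//.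
  by rewrite (bigD1 i)//= lerDl sumr_ge0.
- by move=> _ [A mA ->]; exact: m12.
Qed.

Definition insert n (i : 'I_n.+1) (x : RR) (t : n.-tuple RR) :
    n.+1.-tuple RR :=
  [tuple if unlift i j is Some k then tnth t k else x | j < n.+1].

Lemma tnth_insert_eq n (i : 'I_n.+1) x t : tnth (insert i x t) i = x.
Proof. by rewrite tnth_mktuple unlift_none. Qed.

Lemma tnth_insert_lift n (i : 'I_n.+1) x t j :
  tnth (insert i x t) (lift i j) = tnth t j.
Proof. by rewrite tnth_mktuple liftK. Qed.

Lemma measurable_insert n (i : 'I_n.+1) d (T : measurableType d)
    (f : T -> RR) (g : T -> n.-tuple RR) :
  measurable_fun setT f -> measurable_fun setT g ->
  measurable_fun setT (fun x => insert i (f x) (g x)).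
Proof.
move=> mf mg; apply/measurable_fun_tnthP => j.
case: (unliftP i j) => [k|] ->.
  rewrite (_ : _ \o _ = (fun x => tnth (g x) k)).
    by apply: (measurableT_comp (measurable_tnth k)).
  by apply/funext => x /=; rewrite tnth_insert_lift.
rewrite (_ : _ \o _ = f)//.
by apply/funext => x /=; rewrite tnth_insert_eq.
Qed.

(** The measures on tuples are specified by their values on boxes, so this covers Lebesgue measure,
    the product Gaussian measure and the joint law of the [xi i]. The position [i] is arbitrary
    because each coordinate in turn is singled out later. *)
Lemma tonelli_insert n (nu : {sigma_finite_measure set RR -> \bar R})
    (m : {sigma_finite_measure set (n.-tuple RR) -> \bar R})
    (M : {measure set (n.+1.-tuple RR) -> \bar R}) (i : 'I_n.+1)
    (f : n.+1.-tuple RR -> \bar R) :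
  (forall k : nat, nu (centered_itv k) < +oo)%E ->
  (forall A, (forall i, measurable (A i)) ->
    m (box A) = (\prod_j nu (A j))%E) ->
  (forall A, (forall i, measurable (A i)) ->
    M (box A) = (\prod_j nu (A j))%E) ->
  measurable_fun [set: n.+1.-tuple RR] f -> (forall t, 0 <= f t)%E ->
  (\int[M]_t f t = \int[nu]_x \int[m]_t f (insert i x t))%E.
Proof.
move=> nuoo mE ME mf f0.
pose phi (p : RR * n.-tuple RR) := insert i p.1 p.2.
have mphi : measurable_fun setT phi by exact: measurable_insert.
have M_eq A : measurable A ->
    M A = pushforward (nu \x m)%E phi A.
  pose mphi' := isMeasurableFun.Build _ _ _ _ phi mphi.
  pose phi' : {mfun _ >-> _} := HB.pack phi mphi'.
  apply: (@measure_tuple_unique _ M (pushforward (nu \x m)%E phi')).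
    move=> {}A mA; rewrite ME//.
    rewrite -[RHS]/((nu \x m)%E (phi' @^-1` box A)).
    have -> : phi' @^-1` box A = A i `*` box (fun j : 'I_n => A (lift i j)).
      apply/seteqP; split => -[x t]; rewrite /phi' /= /phi /=.
        move=> /= tA; split; first by have := tA i; rewrite tnth_insert_eq.
        by move=> j; have := tA (lift i j); rewrite tnth_insert_lift.
      move=> [xA tA] j; case: (unliftP i j) => [k|] ->.
        by rewrite tnth_insert_lift; exact: tA.
      by rewrite tnth_insert_eq.
    rewrite product_measure1E//; last exact: measurable_box.
    by rewrite mE// (bigD1_ord i).
  move=> k; rewrite ME; last by move=> _; exact: measurable_itv.
  rewrite -ge0_fin_numE ?prode_ge0// prode_fin_num// => j _.
  by rewrite ge0_fin_numE.
rewrite (eq_measure_integral (pushforward (nu \x m)%E phi)); last first.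
  by move=> A mA _; exact: M_eq.
rewrite ge0_integral_pushforward//= preimage_setT.
rewrite (fubini_tonelli1 (f \o phi))//.
exact: measurableT_comp.
by move=> x; exact: f0.
Qed.

End tuple_measures.

(** * Affine and even changes of variables on the line *)

Section real_integrals.
Context {R : realType}.
Notation mu := (@lebesgue_measure R).
Local Open Scope ereal_scope.
Implicit Types f : R -> \bar R.

(** The scaled image of Lebesgue measure has the right value on half-open intervals, which
    characterises Lebesgue measure. *)
Lemma lebesgue_measure_affine (a c : R) (A : set R) : (0 < a)%R ->
  measurable A ->
  mu A = a%:E * mu [set x | A (a * x + c)%R].
Proof.
move=> a0 mA.
pose phi (x : measurableTypeR R) : measurableTypeR R := (a * x + c)%R.
have mphi : measurable_fun [set: measurableTypeR R] phi.
  have : measurable_fun [set: R] (fun x : R => a * x + c)%R.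
    by apply: measurable_funD => //; exact: measurable_funM.
  exact.
pose mphi' := isMeasurableFun.Build _ _ _ _ phi mphi.
pose phi' : {mfun measurableTypeR R >-> measurableTypeR R} := HB.pack phi mphi'.
pose k : {nonneg R} := NngNum (ltW a0).
rewrite (@lebesgue_measure_unique R (mscale k (pushforward mu phi')))//.
move=> _ [[x y] _ <-].
rewrite -[RHS]/(a%:E * mu (phi' @^-1` _)).
have -> : phi' @^-1` [set` `]x, y]%R] = [set` `](x - c) / a, (y - c) / a]%R].
  apply/seteqP; split => z; rewrite /= !in_itv/= /phi;
    by rewrite ltr_pdivrMr// ler_pdivlMr// ltrBlDr lerBrDr mulrC.
rewrite !lebesgue_measure_itv/= !lte_fin ltr_pM2r ?invr_gt0// ltrD2r.
case: ifPn => _; last by rewrite mule0.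
by rewrite -!EFinB -EFinM -mulrBl mulrC divfK ?gt_eqF// opprB addrA subrK.
Qed.

Lemma ge0_integral_affine (a c : R) f : (0 < a)%R -> measurable_fun setT f ->
  (forall x, 0 <= f x) ->
  \int[mu]_x f x = a%:E * \int[mu]_x f (a * x + c)%R.
Proof.
move=> a0 mf f0.
pose phi (x : measurableTypeR R) : measurableTypeR R := (a * x + c)%R.
have mphi : measurable_fun [set: measurableTypeR R] phi.
  have : measurable_fun [set: R] (fun x : R => a * x + c)%R.
    by apply: measurable_funD => //; exact: measurable_funM.
  exact.
pose mphi' := isMeasurableFun.Build _ _ _ _ phi mphi.
pose phi' : {mfun measurableTypeR R >-> measurableTypeR R} := HB.pack phi mphi'.
pose k : {nonneg R} := NngNum (ltW a0).
rewrite (eq_measure_integral (mscale k (pushforward mu phi'))); last first.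
  by move=> A mA _; exact: lebesgue_measure_affine.
rewrite ge0_integral_mscale//; congr (_ * _).
by rewrite ge0_integral_pushforward.
Qed.

Lemma ge0_integral_even f : measurable_fun setT f -> (forall x, 0 <= f x) ->
  \int[mu]_x f `|x|%R = 2%:E * \int[mu]_(x in `[0%R, +oo[) f x.
Proof.
move=> mf f0.
have mfn : measurable_fun setT (fun x : R => f `|x|%R).
  by apply: measurableT_comp => //; exact: measurableT_comp.
rewrite -[X in integral _ X _](setUv (`[0%R, +oo[ : set R)).
rewrite ge0_integral_setU//=; last 3 first.
  exact: measurableC.
  by rewrite setUv.
  exact/disj_setPCl.
rewrite mule_natl mule2n; congr +%E.
  by apply: eq_integral => x; rewrite inE/= in_itv/= andbT => x0; rewrite ger0_norm.
rewrite setCitvr integral_itv_bndo_bndc; last exact: measurable_funTS.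
transitivity (\int[mu]_(x in `[0%R, +oo[) f `|x|%R).
  rewrite (@ge0_integration_by_substitution0 _ (fun x => f `|x|%R))//.
  by apply: eq_integral => x _; rewrite normrN.
by apply: eq_integral => x; rewrite inE/= in_itv/= andbT => x0; rewrite ger0_norm.
Qed.

End real_integrals.

(** * The nearest point of the cross-polytope *)

Section soft_threshold.
Context {R : realType} {n : nat}.
Implicit Types (x : 'I_n -> R) (s : R).

Definition exceed_count s x : nat := (\sum_(i < n) (s < `|x i|)%R)%N.

(** The l1 norm of the soft thresholding of [x] at level [s]. *)
Definition exceed_sum s x : R := \sum_(i < n) Num.max (`|x i| - s) 0.

Definition trunc_sqnorm s x : R := \sum_(i < n) (Num.min `|x i| s) ^+ 2.

(* The value [s >= 0] solving [exceed_sum s x = 1], or 0 when [x] lies in the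
   cross-polytope: on the set [J] of exceeding coordinates the equation reads
   [\sum_(i in J) `|x i| - #|J| * s = 1], and other [J] give smaller values. *)
Definition threshold x : R :=
  \big[Num.max/0]_(J : {set 'I_n} | J != finset.set0)
    ((\sum_(i in J) `|x i| - 1) / #|J|%:R).

Lemma threshold_ge0 x : 0 <= threshold x.
Proof.
rewrite /threshold; elim/big_rec : _ => // J y _ y0.
by rewrite le_max y0 orbT.
Qed.

Lemma sum_sub_card (J : {set 'I_n}) s x :
  \sum_(i in J) (`|x i| - s) = \sum_(i in J) `|x i| - s * #|J|%:R.
Proof. by rewrite big_split/= sumrN sumr_const mulr_natr. Qed.

Lemma sum_sub_le_exceed_sum (J : {set 'I_n}) s x :
  \sum_(i in J) (`|x i| - s) <= exceed_sum s x.
Proof.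
rewrite /exceed_sum [leRHS](bigID (mem J))/= -[leLHS]addr0 lerD//.
  by apply: ler_sum => i _; rewrite le_max lexx.
by apply: sumr_ge0 => i _; rewrite le_max lexx orbT.
Qed.

Lemma exceed_sumE s x :
  exceed_sum s x = \sum_(i in finset (fun i => s < `|x i|)) (`|x i| - s).
Proof.
rewrite /exceed_sum (bigID (fun i => s < `|x i|))/= [X in _ + X]big1 ?addr0.
  apply: eq_big => [i|i si]; first by rewrite finset.in_set.
  by rewrite max_l// subr_ge0 ltW.
by move=> i; rewrite -leNgt => xis; rewrite max_r// subr_le0.
Qed.

(** [threshold x <= s] says that [\sum_(i in J) (|x i| - s) <= 1] for every nonempty [J]; the
    maximum of these sums over all [J] is [exceed_sum s x], attained at the set of exceeding
    coordinates. *)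
Lemma threshold_le s x : 0 <= s -> (threshold x <= s) = (exceed_sum s x <= 1).
Proof.
move=> s0; apply/idP/idP.
  move=> /bigmax_leP[_ tx]; rewrite exceed_sumE.
  set J := finset _; have [->|J0] := eqVneq J finset.set0; first by rewrite big_set0.
  have := tx _ J0; rewrite sum_sub_card ler_pdivrMr ?ltr0n ?card_gt0//.
  by lra.
move=> e1; apply/bigmax_leP; split => // J J0.
rewrite ler_pdivrMr ?ltr0n ?card_gt0//.
have := sum_sub_le_exceed_sum J s x; rewrite sum_sub_card.
by move: e1; lra.
Qed.

Lemma exceed_sum_threshold_le1 x : exceed_sum (threshold x) x <= 1.
Proof. by rewrite -threshold_le ?threshold_ge0. Qed.

(** A positive maximum is reached at some [J], whose terms [|x i| - threshold x] then sum to exactly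
    1; [exceed_sum] dominates this sum. *)
Lemma exceed_sum_threshold x : 0 < threshold x -> exceed_sum (threshold x) x = 1.
Proof.
move=> t0; apply/eqP; rewrite eq_le exceed_sum_threshold_le1/=.
have [J J0 tE] : exists2 J : {set 'I_n}, J != finset.set0 &
    threshold x = (\sum_(i in J) `|x i| - 1) / #|J|%:R.
  apply: contrapT => h; suff : threshold x < threshold x by rewrite ltxx.
  rewrite [ltLHS]/threshold; apply/bigmax_ltP; split => // J J0.
  rewrite lt_neqAle; apply/andP; split.
    by apply/eqP => e; apply: h; exists J.
  exact: (le_bigmax_cond _ (fun J : {set 'I_n} =>
    (\sum_(i in J) `|x i| - 1) / #|J|%:R)).
have := sum_sub_le_exceed_sum J (threshold x) x.
rewrite sum_sub_card {1}tE divfK ?pnatr_eq0 ?cards_eq0//.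
by rewrite opprB addrC subrK.
Qed.

(** Strict monotonicity where the excess is positive makes the level of total excess 1 unique. *)
Lemma exceed_sum_lt s s' x : s < s' -> 0 < exceed_sum s' x ->
  exceed_sum s' x < exceed_sum s x.
Proof.
move=> ss' e0.
have [i si] : exists i, s' < `|x i|.
  apply: contrapT => h; move: e0; rewrite ltNge => /negP; apply.
  apply: sumr_le0 => i _; rewrite ge_max lexx andbT subr_le0 leNgt.
  by apply/negP => si; apply: h; exists i.
rewrite /exceed_sum (bigD1 i)//= [ltRHS](bigD1 i)//=.
apply: ltr_leD.
  rewrite !max_l ?subr_ge0 ?ltrD2l ?ltrN2//; [|exact: ltW..].
  by rewrite ltW// (lt_trans ss').
apply: ler_sum => j _; rewrite ge_max !le_max lexx orbT andbT.
by rewrite lerD2l lerN2 ltW.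
Qed.

Lemma threshold_eq s x : 0 <= s -> exceed_sum s x = 1 -> threshold x = s.
Proof.
move=> s0 e1; apply/eqP; rewrite eq_le threshold_le// e1 lexx/= leNgt.
apply/negP => ts; have := @exceed_sum_lt _ _ x ts.
by rewrite e1 => /(_ ltr01); rewrite ltNge exceed_sum_threshold_le1.
Qed.

Lemma exceed_count_threshold_gt0 x : 0 < threshold x ->
  (0 < exceed_count (threshold x) x)%N.
Proof.
move=> /exceed_sum_threshold e1; rewrite lt0n sum_nat_eq0; apply/negP.
move=> /forallP h; move: e1; rewrite /exceed_sum big1 => [/eqP|i _].
  by rewrite eq_sym oner_eq0.
have := h i; rewrite eqb0 -leNgt => xi.
by rewrite max_r// subr_le0.
Qed.

Lemma exceed_count_le s x : (exceed_count s x <= n)%N.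
Proof.
rewrite -[leqRHS]card_ord -sum1_card; apply: leq_sum => i _.
exact: leq_b1.
Qed.

End soft_threshold.

Section cross_polytope.
Context {R : realType} {n : nat}.
Implicit Types (v p : 'rV[R]_n.+1).

Lemma convex_setP (A : set 'rV[R]_n.+1) : convex_set A <->
  (forall x y (l : R), 0 <= l <= 1 -> A x -> A y -> A (l *: x + (1 - l) *: y)).
Proof.
split => [cA x y l /andP[l0 l1] Ax Ay|cA x y l /set_mem Ax /set_mem Ay].
  have l01 : Itv.spec (@Itv.num_sem R) (Itv.Real `[0%Z, 1%Z]) l.
    by apply/and3P; split; rewrite ?num_real.
  have := cA x y (Itv.mk l01) (mem_set Ax) (mem_set Ay).
  by rewrite inE.
rewrite inE; apply: cA => //; apply/andP; split; first exact: ge0.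
exact: le1.
Qed.

Lemma convex_sum (A : set 'rV[R]_n.+1) (I : Type) (s : seq I)
    (w : I -> R) (u : I -> 'rV[R]_n.+1) :
  convex_set A -> A 0 -> (forall i, 0 <= w i) -> (forall i, A (u i)) ->
  \sum_(i <- s) w i <= 1 -> A (\sum_(i <- s) w i *: u i).
Proof.
move=> /convex_setP cA A0 w0 Au.
(* Allowing any positive bound [c] of the total weight lets the induction rescale: the tail is
   handled with [c - w i]. *)
suff H c : \sum_(i <- s) w i <= c -> 0 < c -> A (c^-1 *: \sum_(i <- s) w i *: u i).
  by move=> /H/(_ ltr01); rewrite invr1 scale1r.
elim: s c => [|i s IH] c; first by rewrite !big_nil scaler0.
rewrite !big_cons => wc c0.
(* If the first weight uses up all of [c], one cannot divide by [c - w i], but the remaining weights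
   vanish. *)
have [wc1|wc1] := eqVneq c (w i).
  have s0 : \sum_(j <- s) w j *: u j = 0.
    have s0 : \sum_(j <- s) w j = 0.
      by apply/eqP; rewrite eq_le sumr_ge0 ?andbT//; move: wc; rewrite wc1; lra.
    elim: s {IH wc} s0 => [|j s IHs]; first by rewrite !big_nil.
    rewrite !big_cons => /eqP; rewrite paddr_eq0 ?sumr_ge0// => /andP[/eqP -> /eqP/IHs ->].
    by rewrite scale0r addr0.
  by rewrite s0 addr0 scalerA -wc1 mulVf ?gt_eqF// scale1r.
have sge0 : 0 <= \sum_(j <- s) w j by exact: sumr_ge0.
have cw : 0 < c - w i.
  by rewrite subr_gt0 lt_neqAle eq_sym wc1/=; move: wc sge0; lra.
have := cA (u i) ((c - w i)^-1 *: \sum_(j <- s) w j *: u j) (c^-1 * w i).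
rewrite scalerA (_ : (1 - c^-1 * w i) / (c - w i) = c^-1); last first.
  by field; rewrite !gt_eqF.
rewrite scalerDr scalerA; apply => //.
  rewrite mulr_ge0 ?invr_ge0 ?(ltW c0)//= mulrC ler_pdivrMr// mul1r.
  by move: cw; lra.
by apply: IH => //; move: wc; lra.
Qed.

Lemma cross_polytopeE :
  cross_polytope R n.+1 = [set v | \sum_i `|v 0 i| <= 1].
Proof.
apply/seteqP; split.
  apply: smallest_sub.
    apply/convex_setP => x y l /andP[l0 l1] /= x1 y1.
    apply: (@le_trans _ _ (l * (\sum_i `|x 0 i|) + (1 - l) * (\sum_i `|y 0 i|))).
      rewrite !mulr_sumr -big_split/=; apply: ler_sum => i _.
      rewrite !mxE (le_trans (ler_normD _ _))// !normrM (ger0_norm l0).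
      by rewrite (@ger0_norm _ (1 - l))// subr_ge0.
    have : l * (\sum_i `|x 0 i|) <= l * 1 by rewrite ler_wpM2l.
    have : (1 - l) * (\sum_i `|y 0 i|) <= (1 - l) * 1 by rewrite ler_wpM2l// subr_ge0.
    lra.
  move=> _ [i [|] ->] /=; rewrite (bigD1 i)//= big1 ?addr0 => [|j /negPf ji];
    by rewrite !mxE/= ?eqxx/= ?normrN ?normr1// ji/= ?oppr0 normr0.
move=> v /= v1.
have cC : convex_set (cross_polytope R n.+1).
  apply/convex_setP => x y l l01 Cx Cy M [cM EM].
  by move/convex_setP : (cM); apply; [|apply: Cx|apply: Cy].
have Ce i : cross_polytope R n.+1 (delta_mx 0 i).
  by apply: sub_gen_smallest; exists i; left.
have CNe i : cross_polytope R n.+1 (- delta_mx 0 i).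
  by apply: sub_gen_smallest; exists i; right.
have C0 : cross_polytope R n.+1 0.
  have := (convex_setP _).1 cC _ _ 2^-1 _ (Ce ord0) (CNe ord0).
  rewrite (_ : 2^-1 *: _ + _ = 0); last first.
    by rewrite scalerN -scalerBl [X in X *: _](_ : _ = 0) ?scale0r//; lra.
  by apply; lra.
(* [v] combines the vertices carrying the signs of its coordinates, with weights [|v 0 i|]. *)
rewrite (row_sum_delta v) (eq_bigr (fun i : 'I_n.+1 => `|v 0 i| *:
    (if 0 <= v 0 i then delta_mx 0 i else - delta_mx 0 i))).
  by apply: convex_sum => // i; case: ifP.
move=> i _; case: ifPn => [v0|]; first by rewrite ger0_norm.
by rewrite -ltNge => v0; rewrite ltr0_norm// scaleNr scalerN opprK.
Qed.

(** For [s >= 0], the projection of [y] onto [[-s, s]], so that [y - clamp s y] is the soft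
    thresholding of [y]. *)
Definition clamp (s y : R) : R := Num.max (- s) (Num.min y s).

Lemma norm_clamp s y : 0 <= s -> `|clamp s y| = Num.min `|y| s.
Proof.
rewrite /clamp => s0; have [y0|y0] := leP 0 y.
  rewrite (ger0_norm y0) max_r; last by rewrite le_min; apply/andP; split; lra.
  by rewrite ger0_norm// le_min y0.
rewrite (ltr0_norm y0) (min_l (ltW _)) ?(lt_le_trans y0)// ler0_norm.
  by rewrite oppr_max opprK minC.
by rewrite ge_max oppr_le0 s0 ltW.
Qed.

Lemma norm_sub_clamp s y : 0 <= s -> `|y - clamp s y| = Num.max (`|y| - s) 0.
Proof.
rewrite /clamp => s0; have [y0|y0] := leP 0 y.
  rewrite (ger0_norm y0) max_r; last by rewrite le_min; apply/andP; split; lra.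
  have [ys|sy] := leP y s; first by rewrite subrr normr0 max_r// subr_le0.
  by rewrite ger0_norm ?subr_ge0 ?ltW// max_l// subr_ge0 ltW.
rewrite (ltr0_norm y0) (min_l (ltW _)) ?(lt_le_trans y0)//.
have [sy|ys] := leP (- s) y.
  by rewrite subrr normr0 max_r//; lra.
by rewrite ler0_norm ?max_l//; lra.
Qed.

(** Complementary slackness: outside [[-s, s]] the clamp is [s] times the sign of the remainder;
    inside, the remainder is 0. *)
Lemma clamp_mul_sub s y : 0 <= s ->
  clamp s y * (y - clamp s y) = s * `|y - clamp s y|.
Proof.
rewrite /clamp => s0; have [y0|y0] := leP 0 y.
  rewrite max_r; last by rewrite le_min; apply/andP; split; lra.
  have [ys|sy] := leP y s; first by rewrite subrr normr0 !mulr0.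
  by rewrite ger0_norm// subr_ge0 ltW.
rewrite (min_l (ltW _)) ?(lt_le_trans y0)//.
have [sy|ys] := leP (- s) y; first by rewrite subrr normr0 !mulr0.
by rewrite ler0_norm; lra.
Qed.

(* The point of the cross-polytope nearest to [v] is the soft thresholding
   [v - clamp (threshold v) v]. *)
Lemma trunc_sqnorm_threshold_le v p : \sum_i `|p 0 i| <= 1 ->
  trunc_sqnorm (threshold (v 0)) (v 0) <= \sum_i (v 0 i - p 0 i) ^+ 2.
Proof.
move=> p1; set s := threshold (v 0).
have s0 : 0 <= s by exact: threshold_ge0.
pose c i := clamp s (v 0 i).
(* With [q = v - c] the candidate, [|v - p|^2 >= |c|^2 + 2 c.(q - p)]; in each coordinate
   [c q = s |q|] and [c p <= s |p|]. *)
apply: (@le_trans _ _ (\sum_i (c i ^+ 2 + 2 * (s * (Num.max (`|v 0 i| - s) 0) - s * `|p 0 i|)))).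
  rewrite big_split/= -mulr_sumr sumrB -!mulr_sumr.
  rewrite /trunc_sqnorm (eq_bigr (fun i => c i ^+ 2)); last first.
    by move=> i _; rewrite -norm_clamp// real_normK ?num_real.
  rewrite lerDl mulr_ge0// -mulrBr.
  (* When [s > 0] the candidate has l1 norm exactly 1, hence at least that of [p]. *)
  have [->|sn0] := eqVneq s 0; first by rewrite mul0r.
  rewrite mulr_ge0// subr_ge0.
  have := @exceed_sum_threshold R n.+1 (v 0); rewrite /exceed_sum -/s => ->//.
  by rewrite lt_neqAle eq_sym sn0.
apply: ler_sum => i _.
rewrite -norm_sub_clamp// -clamp_mul_sub// -/(c i).
have cp : c i * p 0 i <= s * `|p 0 i|.
  rewrite (le_trans (ler_norm _))// normrM ler_wpM2r// norm_clamp//.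
  by rewrite ge_min lexx orbT.
have := sqr_ge0 (v 0 i - c i - p 0 i).
by nra.
Qed.

Lemma cross_polytope_parallel_body (r : R) : 0 <= r ->
  [set x + r *: y | x in cross_polytope R n.+1 & y in unit_ball] =
  [set v | trunc_sqnorm (threshold (v 0)) (v 0) <= r ^+ 2].
Proof.
move=> r0; rewrite cross_polytopeE; apply/seteqP; split.
  move=> _ [x /= x1 [y y1 <-]].
  apply: le_trans (trunc_sqnorm_threshold_le _ x1) _.
  under eq_bigr do rewrite !mxE addrAC subrr add0r exprMn.
  rewrite -mulr_sumr ler_piMr ?sqr_ge0//.
  move: y1; rewrite /unit_ball/= /euclidean_norm => y1.
  rewrite -[leLHS]sqr_sqrtr ?sumr_ge0// => [|i _]; last exact: sqr_ge0.
  by rewrite expr_le1 ?sqrtr_ge0.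
move=> v /= vr.
set s := threshold (v 0) in vr.
have s0 : 0 <= s by exact: threshold_ge0.
pose c : 'rV[R]_n.+1 := \row_i clamp s (v 0 i).
have cE : \sum_i c 0 i ^+ 2 = trunc_sqnorm s (v 0).
  by apply: eq_bigr => i _; rewrite mxE -norm_clamp// real_normK ?num_real.
exists (v - c) => /=.
  apply: le_trans (exceed_sum_threshold_le1 (v 0)).
  by apply: ler_sum => i _; rewrite !mxE norm_sub_clamp.
exists (r^-1 *: c); last first.
  (* For [r = 0] the second point is multiplied by 0, so [v - c] must be [v] itself: the bound
     forces [c = 0]. *)
  have [r00|rn0] := eqVneq r 0; last by rewrite scalerA divff// scale1r subrK.
  rewrite r00 scale0r addr0; apply/rowP => i; rewrite !mxE.
  suff : clamp s (v 0 i) = 0 by move=> ->; rewrite subr0.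
  move: vr; rewrite r00 expr0n/= -cE => c0.
  have : \sum_i c 0 i ^+ 2 == 0.
    by rewrite eq_le c0 sumr_ge0// => j _; exact: sqr_ge0.
  rewrite psumr_eq0 => [/allP/(_ i)|j _]; last exact: sqr_ge0.
  by rewrite mem_index_enum/= mxE sqrf_eq0 => /(_ isT)/eqP.
rewrite /unit_ball/= /euclidean_norm.
under eq_bigr do rewrite mxE exprMn.
rewrite -mulr_sumr cE -[leRHS]sqrtr1 ler_wsqrtr// exprVn.
have [->|rn0] := eqVneq r 0; first by rewrite expr0n/= invr0 mul0r.
by rewrite mulrC ler_pdivrMr ?mul1r// exprn_gt0// lt_neqAle eq_sym rn0.
Qed.

End cross_polytope.

(** * Iterated integrals *)

Section indicator.
Context {R : realType}.
Local Open Scope ereal_scope.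

(** Boolean regions are integrated through this indicator: conjunctions become products, and a
    constraint on one variable factors out of the integrals over the others. *)
Definition ind (b : bool) : \bar R := (b%:R)%:E.

Lemma ind_ge0 b : 0 <= ind b.
Proof. by rewrite lee_fin. Qed.

Lemma ind_andb a b : ind (a && b) = ind a * ind b.
Proof. by rewrite /ind -EFinM -natrM mulnb. Qed.

Lemma measurable_ind d (T : measurableType d) (b : T -> bool) :
  measurable_fun setT b -> measurable_fun setT (fun x => ind (b x)).
Proof.
move=> mb; rewrite (_ : (fun x => _) = (fun x => if b x then 1 else 0)).
  exact: measurable_fun_ifT.
by apply/funext => x; rewrite /ind; case: (b x).
Qed.

Lemma integral_ind d (T : measurableType d) (m : {measure set T -> \bar R})
    (b : T -> bool) : measurable_fun setT b ->
  \int[m]_x ind (b x) = m [set x | b x].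
Proof.
move=> mb; have mS : measurable [set x | b x].
  by rewrite -[X in measurable X]setTI; apply: mb.
rewrite -[X in m X]setIT -integral_indic//; apply: eq_integral => x _.
by rewrite /ind indicE; congr ((nat_of_bool _)%:R%:E); apply/idP/idP; rewrite inE.
Qed.

Lemma integral_ind_mul d (T : measurableType d) (m : {measure set T -> \bar R})
    (b : T -> bool) (f : T -> \bar R) :
  \int[m]_(x in [set x | b x]) f x = \int[m]_x (ind (b x) * f x).
Proof.
rewrite integral_mkcond; apply: eq_integral => x _.
rewrite /patch /ind; case: ifPn => [/set_mem /= ->|].
  by rewrite mul1e.
by move=> /negP xb; case: (boolP (b x)) => bx; rewrite ?mul0e//; case: xb; rewrite inE.
Qed.

End indicator.

Section slab.
Context {R : realType}.
Notation RR := (measurableTypeR R).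
Notation mu := (@lebesgue_measure R).
Local Open Scope ereal_scope.

(* The volume of [{x in [0, s]^j | \sum_i x_i ^ 2 <= b}]. *)
Fixpoint slab (j : nat) (s b : R) : \bar R :=
  if j is j'.+1 then
    \int[mu]_x (ind (0 <= x <= s)%R * slab j' s (b - x ^+ 2)%R)
  else ind (0 <= b)%R.

Lemma slab_ge0 j s b : 0 <= slab j s b.
Proof.
elim: j b => [|j IH] b /=; first exact: ind_ge0.
by apply: integral_ge0 => x _; rewrite mule_ge0 ?ind_ge0.
Qed.

(** The parameters are arbitrary measurable functions because the induction step passes from [T] to
    [T * RR], where they absorb the new variable. *)
Lemma measurable_slab j d (T : measurableType d) (f g : T -> R) :
  measurable_fun setT f -> measurable_fun setT g ->
  measurable_fun setT (fun x => slab j (f x) (g x)).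
Proof.
elim: j d T f g => [|j IH] d T f g mf mg /=.
  by apply: measurable_ind; exact: measurable_fun_ler.
pose F (p : T * RR) :=
  ind (0 <= p.2 <= f p.1)%R * slab j (f p.1) (g p.1 - p.2 ^+ 2)%R.
have m2 : measurable_fun setT (fun p : T * RR => p.2 : R) by exact: measurable_snd.
have mf1 : measurable_fun setT (fun p : T * RR => f p.1).
  by apply: measurableT_comp => //; exact: measurable_fst.
have mg1 : measurable_fun setT (fun p : T * RR => g p.1).
  by apply: measurableT_comp => //; exact: measurable_fst.
apply: (measurable_fun_fubini_tonelli_F F) => [|p]; last first.
  by rewrite mule_ge0 ?ind_ge0 ?slab_ge0.
apply: emeasurable_funM.
  by apply: measurable_ind; apply: measurable_and; exact: measurable_fun_ler.
apply: IH => //; apply: measurable_funB => //; exact: measurable_funX.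
Qed.

Lemma slab_lt0 j s b : (b < 0)%R -> slab j s b = 0.
Proof.
elim: j b => [|j IH] b b0 /=; first by rewrite /ind leNgt b0.
apply: integral0_eq => x _; rewrite IH ?mule0//.
by rewrite subr_lt0 (lt_le_trans b0)// sqr_ge0.
Qed.

Lemma integral_ind_itv (a b : R) : (a <= b)%R ->
  \int[mu]_x ind (a <= x <= b)%R = (b - a)%:E.
Proof.
move=> ab; rewrite (@integral_ind _ _ RR mu); last first.
  by apply: measurable_and; exact: measurable_fun_ler.
rewrite (_ : [set x | _] = [set` `[a, b]%R]).
  rewrite [LHS](lebesgue_measure_itv `[a, b])/= lte_fin.
  by move: ab; rewrite le_eqVlt => /predU1P[->|->]; rewrite ?ltxx ?subrr// -EFinB.
by apply/seteqP; split => x; rewrite /= in_itv.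
Qed.

Lemma slab_le j s b : (0 <= s)%R -> slab j s b <= (s ^+ j)%:E.
Proof.
move=> s0; elim: j b => [|j IH] b /=; first by rewrite /ind lee_fin; case: (0 <= b)%R; rewrite ?ler01 ?lexx.
rewrite exprS.
apply: (@le_trans _ _ (\int[mu]_x (ind (0 <= x <= s)%R * (s ^+ j)%:E))).
  apply: ge0_le_integral => //.
  - by move=> x _; rewrite mule_ge0 ?ind_ge0 ?slab_ge0.
  - apply: emeasurable_funM.
      by apply: measurable_ind; apply: measurable_and; exact: measurable_fun_ler.
    by apply: measurable_slab => //; apply: measurable_funB.
  - apply: emeasurable_funM => //.
    by apply: measurable_ind; apply: measurable_and; exact: measurable_fun_ler.
  - by move=> x _; rewrite lee_wpmul2l ?ind_ge0.
rewrite ge0_integralZr//; last 3 first.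
  - by apply: measurable_ind; apply: measurable_and; exact: measurable_fun_ler.
  - by move=> *; exact: ind_ge0.
  - by rewrite lee_fin exprn_ge0.
by rewrite integral_ind_itv// subr0.
Qed.

Lemma slab_scale j (r s b : R) : (0 < r)%R ->
  slab j (r * s)%R (r ^+ 2 * b)%R = (r ^+ j)%:E * slab j s b.
Proof.
move=> r0; elim: j b => [|j IH] b /=.
  by rewrite expr0 mul1e pmulr_rge0// exprn_gt0.
rewrite (@ge0_integral_affine _ r 0)//; last 2 first.
- apply: emeasurable_funM.
    by apply: measurable_ind; apply: measurable_and; exact: measurable_fun_ler.
  by apply: measurable_slab => //; apply: measurable_funB.
- by move=> x; rewrite mule_ge0 ?ind_ge0 ?slab_ge0.
rewrite [(r ^+ j.+1)%R]exprS EFinM -muleA; congr (_ * _).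
rewrite -ge0_integralZl//; last 3 first.
- apply: emeasurable_funM.
    by apply: measurable_ind; apply: measurable_and; exact: measurable_fun_ler.
  by apply: measurable_slab => //; apply: measurable_funB.
- by move=> x _; rewrite mule_ge0 ?ind_ge0 ?slab_ge0.
- by rewrite lee_fin exprn_ge0// ltW.
apply: eq_integral => x _.
rewrite addr0 exprMn -mulrBr IH muleCA; congr (_ * _).
by rewrite pmulr_rge0// ler_pM2l.
Qed.

End slab.

Section gauss_partial.
Context {R : realType}.
Notation RR := (measurableTypeR R).
Notation mu := (@lebesgue_measure R).
Local Open Scope ereal_scope.

(** Adds one coordinate to a simplex of size [a]: an exceeding coordinate [x] leaves [s + a - x] for
    the others. *)
Lemma integral_power (k : nat) (s a : R) : (0 < a)%R ->
  \int[mu]_x (ind (s < x < s + a)%R * ((s + a - x) ^+ k)%:E) =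
  (a ^+ k.+1 / k.+1%:R)%:E.
Proof.
move=> a0; rewrite -(@integral_ind_mul _ _ RR mu).
pose q : {poly R} := ((s + a)%:P - 'X)%R.
pose p : {poly R} := (- (k.+1%:R^-1 *: q ^+ k.+1))%R.
have qE x : q.[x] = (s + a - x)%R by rewrite !hornerE.
have dp : (p^`() = q ^+ k)%R.
  rewrite derivN derivZ deriv_exp /= derivB derivC derivX sub0r mulN1r.
  rewrite mulNrn scalerN opprK -[(q ^+ k *+ _)%R]scaler_nat.
  by rewrite scalerA mulVf ?pnatr_eq0// scale1r.
rewrite (_ : [set x | _] = [set` `]s, (s + a)%R[]); last first.
  by apply/seteqP; split => x; rewrite /= in_itv.
under eq_integral do rewrite -qE -horner_exp -dp.
have cp (u : {poly R}) : continuous (horner u) by exact: continuous_horner.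
rewrite -(@integral_itv_bndoo _ s (s + a)%R _ true false); last first.
  apply/measurable_EFinP; apply: measurable_funTS.
  by apply: continuous_measurable_fun; exact: cp.
rewrite (@continuous_FTC2 _ _ (horner p)).
- rewrite /p !hornerN !hornerZ !horner_exp !qE subrr addrAC subrr add0r expr0n/=.
  by rewrite mulr0 oppr0 -EFinB sub0r opprK mulrC.
- by rewrite ltrDl.
- by apply: continuous_subspaceT; exact: cp.
- split => [x _||]; first exact: ex_derive.
  + by apply: cvg_at_right_filter; exact: cp.
  + by apply: cvg_at_left_filter; exact: cp.
- by move=> x _; rewrite derive1E derive_val.
Qed.

Definition gauss_int (s : R) : R :=
  (\int[mu]_(x in `[0, s]) expR (- x ^+ 2 / 2))%R.

Let g (x : R) := expR (- x ^+ 2 / 2).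

Lemma continuous_gauss : continuous g.
Proof.
move=> x; apply: (@continuous_comp _ _ _ (fun x : R => - x ^+ 2 / 2)%R expR).
  apply: cvgMr_tmp; apply: cvgN; exact: exprn_continuous.
exact: continuous_expR.
Qed.

Lemma integrable_gauss_itv s : mu.-integrable `[0%R, s] (EFin \o g).
Proof.
apply: continuous_compact_integrable; first exact: segment_compact.
by apply: continuous_subspaceT; exact: continuous_gauss.
Qed.

Lemma gauss_intE s :
  (gauss_int s)%:E = \int[mu]_x (ind (0 <= x <= s)%R * (g x)%:E).
Proof.
rewrite -(@integral_ind_mul _ _ RR mu) /gauss_int /Rintegral fineK.
  rewrite (_ : [set x | (0 <= x <= s)%R] = [set` `[0%R, s]])//.
exact: (integrable_fin_num _ (integrable_gauss_itv s)).
Qed.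

Lemma gauss_int_ge0 s : (0 <= gauss_int s)%R.
Proof. by apply: Rintegral_ge0 => // x _; exact: expR_ge0. Qed.

Lemma integral_expRN (c : R) :
  \int[mu]_(x in `[c, +oo[) (expR (- x))%:E = (expR (- c))%:E.
Proof.
rewrite (@ge0_continuous_FTC2y _ _ (fun x => - expR (- x))%R c 0%R).
- by rewrite -EFinB sub0r opprK.
- by move=> x _; exact: expR_ge0.
- apply: continuous_subspaceT => x.
  by apply: continuous_comp; [exact: opp_continuous|exact: continuous_expR].
- rewrite -[X in _ --> X]oppr0; apply: cvgN; exact: cvgr_expR.
- by move=> x _.
- apply: cvg_at_right_filter; apply: cvgN.
  by apply: continuous_comp; [exact: opp_continuous|exact: continuous_expR].
- move=> x _; rewrite derive1E.
  have := @is_deriveN _ _ _ _ x 1%R _ (is_derive1_comp (is_derive_expR (- x)) (is_deriveNid x 1%R)).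
  move=> /@derive_val ->; by rewrite /GRing.scale/= mulrN1 opprK.
Qed.

(** Integrating [e^(- u)] over [u >= (c + |x|^2) / 2] gives [e^(- (c + |x|^2) / 2)], which factors
    over the coordinates of [x] in [[0, s]^j]. The offset [c] collects the squares of the
    coordinates already peeled off. *)
Lemma layer_cake j (s c : R) : (0 <= c)%R ->
  \int[mu]_u (ind (0 <= u)%R * (expR (- u))%:E * slab j s (2 * u - c)%R) =
  (expR (- c / 2) * gauss_int s ^+ j)%:E.
Proof.
elim: j c => [|j IH] c c0.
  rewrite expr0 mulr1 mulNr -integral_expRN.
  rewrite (_ : [set` _] = [set x | c / 2 <= x]%R).
    rewrite integral_ind_mul.
    apply: eq_integral => x _ /=; rewrite muleAC -ind_andb; congr (ind _ * _).
    rewrite subr_ge0 ler_pdivrMr// mulrC.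
    by have [xc|] := leP c (x * 2)%R; rewrite ?andbF// andbT; lra.
  by apply/seteqP; split => x; rewrite /= in_itv/= andbT.
have m2 d (T : measurableType d) (f : T -> R) : measurable_fun setT f ->
    measurable_fun setT (fun x => ind (0 <= f x <= s)%R).
  move=> mf; apply: measurable_ind.
  by apply: measurable_and; exact: measurable_fun_ler.
pose F (p : RR * RR) := ind (0 <= p.1)%R * (expR (- p.1))%:E *
   (ind (0 <= p.2 <= s)%R * slab j s (2 * p.1 - c - p.2 ^+ 2)%R).
have mF : measurable_fun setT F.
  have mp1 : measurable_fun setT (fun p : RR * RR => p.1 : R) by exact: measurable_fst.
  have mp2 : measurable_fun setT (fun p : RR * RR => p.2 : R) by exact: measurable_snd.
  apply: emeasurable_funM; apply: emeasurable_funM.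
  - by apply: measurable_ind; exact: measurable_fun_ler.
  - by apply/measurable_EFinP; apply: measurableT_comp => //; exact: measurableT_comp.
  - exact: m2.
  - apply: measurable_slab => //; apply: measurable_funB; last exact: measurable_funX.
    by apply: measurable_funB => //; exact: measurable_funM.
have F0 p : 0 <= F p.
  by rewrite /F !mule_ge0 ?ind_ge0 ?slab_ge0// lee_fin expR_ge0.
transitivity (\int[mu]_u \int[mu]_x F (u, x)).
  apply: eq_integral => u _; rewrite /F /= ge0_integralZl//.
  - apply: emeasurable_funM; first exact: m2.
    by apply: measurable_slab => //; apply: measurable_funB.
  - by move=> x _; rewrite mule_ge0 ?ind_ge0 ?slab_ge0.
  - by rewrite mule_ge0 ?ind_ge0// lee_fin expR_ge0.
rewrite (fubini_tonelli F)//.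
transitivity (\int[mu]_x ((expR (- c / 2) * gauss_int s ^+ j)%:E *
    (ind (0 <= x <= s)%R * (g x)%:E))).
  apply: eq_integral => x _; rewrite /F /=.
  under eq_integral do rewrite muleCA.
  rewrite ge0_integralZl//; last 3 first.
  - apply: emeasurable_funM.
      apply: emeasurable_funM; first by apply: measurable_ind; exact: measurable_fun_ler.
      by apply/measurable_EFinP; apply: measurableT_comp => //; exact: measurableT_comp.
    apply: measurable_slab => //; apply: measurable_funB => //.
    by apply: measurable_funB => //; exact: measurable_funM.
  - by move=> u _; rewrite !mule_ge0 ?ind_ge0 ?slab_ge0// lee_fin expR_ge0.
  - exact: ind_ge0.
  rewrite muleCA; congr (_ * _).
  under eq_integral do rewrite -addrA -opprD.
  rewrite IH ?addr_ge0 ?sqr_ge0//.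
  by rewrite -EFinM mulrAC -expRD; congr ((expR _ * _)%:E); lra.
rewrite ge0_integralZl//; last 3 first.
- apply: emeasurable_funM; first exact: m2.
  by apply/measurable_EFinP; exact: continuous_measurable_fun continuous_gauss.
- by move=> x _; rewrite mule_ge0 ?ind_ge0// lee_fin expR_ge0.
- by rewrite lee_fin mulr_ge0 ?expR_ge0// exprn_ge0// gauss_int_ge0.
by rewrite -gauss_intE -EFinM exprSr mulrA.
Qed.

End gauss_partial.

(** * Volumes of the parallel bodies *)

Section insert_coordinate.
Context {R : realType}.
Notation RR := (measurableTypeR R).
Variables (m : nat) (i : 'I_m.+1) (x : R) (t : m.-tuple RR).

Lemma exceed_count_insert s : exceed_count s (tnth (insert i x t)) =
  ((s < `|x|)%R + exceed_count s (tnth t))%N.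
Proof.
rewrite /exceed_count (bigD1_ord i)//= tnth_insert_eq; congr (_ + _)%N.
by apply: eq_bigr => j _; rewrite tnth_insert_lift.
Qed.

Lemma exceed_sum_insert s : exceed_sum s (tnth (insert i x t)) =
  Num.max (`|x| - s) 0 + exceed_sum s (tnth t).
Proof.
rewrite /exceed_sum (bigD1_ord i)//= tnth_insert_eq; congr (_ + _).
by apply: eq_bigr => j _; rewrite tnth_insert_lift.
Qed.

Lemma trunc_sqnorm_insert s : trunc_sqnorm s (tnth (insert i x t)) =
  (Num.min `|x| s) ^+ 2 + trunc_sqnorm s (tnth t).
Proof.
rewrite /trunc_sqnorm (bigD1_ord i)//= tnth_insert_eq; congr (_ + _).
by apply: eq_bigr => j _; rewrite tnth_insert_lift.
Qed.

End insert_coordinate.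

Section measurability.
Context {R : realType} d (T : measurableType d) (m : nat).
Notation RR := (measurableTypeR R).
Variables (s : T -> R) (g : T -> m.-tuple RR).
Hypotheses (ms : measurable_fun setT s) (mg : measurable_fun setT g).

Lemma measurable_norm_tnth j : measurable_fun setT (fun x => `|tnth (g x) j : R|).
Proof.
apply: (@measurableT_comp _ _ _ _ _ _ (@Num.norm R R)) => //.
exact: (measurableT_comp (measurable_tnth j)).
Qed.

Lemma measurable_exceed_count_eq k :
  measurable_fun setT (fun x => exceed_count (s x) (tnth (g x)) == k).
Proof.
rewrite (_ : (fun x => _) =
    (fun x => \sum_(j < m) (s x < `|tnth (g x) j|)%R%:R == k%:R :> R)).
  apply: measurable_fun_eqr => //; apply: measurable_sum => j.
  rewrite (_ : (fun x => _) = (fun x => if s x < `|tnth (g x) j| then 1 else 0)).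
    apply: measurable_fun_ifT => //.
    by apply: measurable_fun_ltr => //; exact: measurable_norm_tnth.
  by apply/funext => x; case: (_ < _).
by apply/funext => x; rewrite -natr_sum eqr_nat.
Qed.

Lemma measurable_exceed_sum :
  measurable_fun setT (fun x => exceed_sum (s x) (tnth (g x))).
Proof.
apply: measurable_sum => j; apply: measurable_maxr => //.
by apply: measurable_funB => //; exact: measurable_norm_tnth.
Qed.

Lemma measurable_trunc_sqnorm :
  measurable_fun setT (fun x => trunc_sqnorm (s x) (tnth (g x))).
Proof.
apply: measurable_sum => j; apply: measurable_funX.
by apply: measurable_minr => //; exact: measurable_norm_tnth.
Qed.

Lemma measurable_threshold :
  measurable_fun setT (fun x => threshold (tnth (g x))).
Proof.
rewrite /threshold.
elim: (index_enum _) => [|J r IH].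
  by under eq_fun do rewrite big_nil; exact: measurable_cst.
under eq_fun do rewrite big_cons; case: (J != finset.set0) => //.
apply: measurable_maxr => //; apply: measurable_funM => //.
apply: measurable_funB => //.
under eq_fun do rewrite big_mkcond/=.
apply: measurable_sum => j; case: (j \in J) => //.
exact: measurable_norm_tnth.
Qed.

End measurability.

Section exceed_volume.
Context {R : realType}.
Notation RR := (measurableTypeR R).
Notation mu := (@lebesgue_measure R).
Local Open Scope ereal_scope.

Lemma lebesgue_centered_itv (k : nat) : mu (centered_itv k) < +oo.
Proof.
rewrite [ltLHS](lebesgue_measure_itv `[- (k%:R : R), k%:R]%R)/=.
by case: ifP => // _; rewrite -EFinB ltry.
Qed.

Lemma tonelli_lebesgue_tuple m (i : 'I_m.+1) (f : m.+1.-tuple RR -> \bar R) :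
  measurable_fun [set: m.+1.-tuple RR] f -> (forall t, 0 <= f t) ->
  \int[lebesgue_tuple R m.+1]_t f t =
  \int[mu]_x \int[lebesgue_tuple R m]_t f (insert i x t).
Proof.
move=> mf f0; apply: tonelli_insert => //.
- exact: lebesgue_centered_itv.
- by move=> A mA; exact: lebesgue_tuple_box.
- by move=> A mA; exact: lebesgue_tuple_box.
Qed.

(** [a] and [b] are the budgets left for the total excess over [s] and for the truncated squares;
    removing a coordinate charges its share to them. *)
Definition exceed_region m (k : nat) (s a b : R) (t : m.-tuple RR) : bool :=
  [&& exceed_count s (tnth t) == k, (exceed_sum s (tnth t) < a)%R &
      (trunc_sqnorm s (tnth t) <= b)%R].

Lemma measurable_exceed_region d (T : measurableType d) m k
    (s a b : T -> R) (g : T -> m.-tuple RR) :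
  measurable_fun setT s -> measurable_fun setT a -> measurable_fun setT b ->
  measurable_fun setT g ->
  measurable_fun setT (fun x => exceed_region k (s x) (a x) (b x) (g x)).
Proof.
move=> ms ma mb mg; apply: measurable_and.
  exact: measurable_exceed_count_eq.
apply: measurable_and.
  by apply: measurable_fun_ltr => //; exact: measurable_exceed_sum.
by apply: measurable_fun_ler => //; exact: measurable_trunc_sqnorm.
Qed.

Lemma exceed_sum_ge0 m s (x : 'I_m -> R) : (0 <= exceed_sum s x)%R.
Proof. by apply: sumr_ge0 => j _; rewrite le_max lexx orbT. Qed.

Lemma exceed_region_insert m (i : 'I_m.+1) k s a b (x : R) (t : m.-tuple RR) :
  exceed_region k s a b (insert i x t) =
  if (s < `|x|)%R then (0 < k)%N && exceed_region k.-1 s (a + s - `|x|) (b - s ^+ 2) t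
  else exceed_region k s a (b - x ^+ 2) t.
Proof.
rewrite /exceed_region exceed_count_insert exceed_sum_insert trunc_sqnorm_insert.
have [xs|sx] := leP `|x|%R s => /=.
  rewrite max_r ?subr_le0// add0r real_normK ?num_real//.
  by rewrite lerBrDl.
rewrite max_l; last by rewrite subr_ge0 ltW.
case: k => [|k] /=; first by rewrite ?add1n.
rewrite ?add1n ?eqSS lerBrDl; congr [&& _, _ & _].
by apply/idP/idP; lra.
Qed.

(** [2 ^ m] signs, ['C(m, k)] choices of the exceeding coordinates, and the volume [a ^ k / k!] of
    the simplex of their excesses. *)
Definition region_const (m k : nat) (a : R) : R :=
  ((2 ^+ m * 'C(m, k)%:R) * (a ^+ k / k`!%:R))%R.

Lemma region_const_ge0 m k a : (0 <= a)%R -> (0 <= region_const m k a)%R.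
Proof. by move=> a0; rewrite !mulr_ge0 ?exprn_ge0 ?invr_ge0. Qed.

(** Induction on the first coordinate [x]: if [|x| <= s] it becomes a side of the slab, otherwise it
    charges [|x| - s] to [a] and [s ^ 2] to [b]. The two contributions combine by Pascal's rule. *)
Lemma exceed_region_volume m k (s a b : R) : (0 <= s)%R ->
  \int[lebesgue_tuple R m]_t ind (exceed_region k s a b t) =
  ind (0 < a)%R * ((region_const m k a)%:E * slab (m - k) s (b - k%:R * s ^+ 2)%R).
Proof.
move=> s0; have [a0|a0] := ltP 0%R a; last first.
  rewrite mul0e; apply: integral0_eq => t _.
  by rewrite /exceed_region ltNge (le_trans a0 (exceed_sum_ge0 _ _)) andbF.
rewrite mul1e.
elim: m k a b a0 => [|m IH] k a b a0.
  rewrite /= integral_dirac//; last first.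
    by apply: measurable_ind; exact: measurable_exceed_region.
  rewrite diracT mul1e /exceed_region /exceed_count /exceed_sum /trunc_sqnorm.
  rewrite !big_ord0 a0/= /region_const expr0 mul1r.
  case: k => [|k]; last by rewrite bin0n/= !mul0r mul0e.
  by rewrite bin0 mul0r subr0 expr0 fact0 divr1 !mul1r mul1e.
rewrite (tonelli_lebesgue_tuple ord0); last 2 first.
- by apply: measurable_ind; exact: measurable_exceed_region.
- by move=> t; exact: ind_ge0.
(* The integral over the other coordinates depends on [x] through its absolute value, which yields
   the factor 2. *)
pose G (x : R) : \bar R := ind (x <= s)%R *
    ((region_const m k a)%:E * slab (m - k) s (b - x ^+ 2 - k%:R * s ^+ 2)%R) +
  ind ((0 < k)%N && (s < x)%R) * (ind (0 < a + s - x)%R *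
    ((region_const m k.-1 (a + s - x))%:E *
     slab (m - k.-1) s (b - s ^+ 2 - k.-1%:R * s ^+ 2)%R)).

have mslab n' (c : R) : measurable_fun setT (fun x : R => slab n' s (c - x ^+ 2)%R).
  by apply: measurable_slab => //; apply: measurable_funB.
have G0 x : 0 <= G x.
  rewrite /G adde_ge0//; first by rewrite !mule_ge0 ?ind_ge0 ?slab_ge0// lee_fin region_const_ge0// ltW.
  rewrite mule_ge0 ?ind_ge0//; have [a'0|] := ltP; last by rewrite mul0e.
  by rewrite !mule_ge0 ?ind_ge0 ?slab_ge0// lee_fin region_const_ge0// ltW.
have mG1 : measurable_fun setT (fun x : R => ind (x <= s)%R *
    ((region_const m k a)%:E * slab (m - k) s (b - x ^+ 2 - k%:R * s ^+ 2)%R)).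
  apply: emeasurable_funM; first by apply: measurable_ind; exact: measurable_fun_ler.
  apply: emeasurable_funM => //; under eq_fun do rewrite addrAC.
  exact: mslab.
have mc k' : measurable_fun setT (fun x : R => (region_const m k' (a + s - x))%R).
  apply: measurable_funM => //; apply: measurable_funM => //.
  by apply: measurable_funX; exact: measurable_funB.
have mG2 : measurable_fun setT (fun x : R => ind ((0 < k)%N && (s < x)%R) *
   (ind (0 < a + s - x)%R * ((region_const m k.-1 (a + s - x))%:E *
     slab (m - k.-1) s (b - s ^+ 2 - k.-1%:R * s ^+ 2)%R))).
  apply: emeasurable_funM.
    by apply: measurable_ind; apply: measurable_and => //; exact: measurable_fun_ltr.
  apply: emeasurable_funM.
    by apply: measurable_ind; apply: measurable_fun_ltr => //; exact: measurable_funB.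
  by apply: emeasurable_funM => //; apply/measurable_EFinP; exact: mc.
have mG : measurable_fun setT G by exact: emeasurable_funD.
transitivity (\int[mu]_x G `|x|%R).
  apply: eq_integral => x _; rewrite /G.
  under eq_integral do rewrite exceed_region_insert.
  have [xs|sx] := leP `|x|%R s.
    by rewrite IH// andbF mul0e adde0 mul1e real_normK ?num_real.
  rewrite mul0e add0e andbT; case: k {G G0 mG1 mG2 mG} => [|k] /=.
    by rewrite mul0e integral0.
  rewrite mul1e; have [a'0|a'0] := ltP 0%R (a + s - `|x|)%R; first by rewrite IH// mul1e.
  rewrite mul0e; apply: integral0_eq => t _.
  rewrite /exceed_region ltNge (le_trans a'0 (exceed_sum_ge0 _ _)) andbF.
  by [].
rewrite ge0_integral_even//.
rewrite (_ : [set` _] = [set x | 0 <= x]%R); last first.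
  by apply/seteqP; split => x; rewrite /= in_itv/= andbT.
rewrite integral_ind_mul.
pose A (x : R) : \bar R := (region_const m k a)%:E *
  (ind (0 <= x <= s)%R * slab (m - k) s (b - k%:R * s ^+ 2 - x ^+ 2)%R).
have A0 x : 0 <= A x.
  by rewrite !mule_ge0 ?ind_ge0 ?slab_ge0// lee_fin region_const_ge0// ltW.
have mA : measurable_fun setT A.
  apply: emeasurable_funM => //; apply: emeasurable_funM => //.
  by apply: measurable_ind; apply: measurable_and; exact: measurable_fun_ler.
have AE : \int[mu]_x A x =
    (region_const m k a)%:E * slab (m - k).+1 s (b - k%:R * s ^+ 2)%R.
  rewrite ge0_integralZl//.
  - apply: emeasurable_funM => //.
    by apply: measurable_ind; apply: measurable_and; exact: measurable_fun_ler.
    exact: mslab.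
  - by move=> x _; rewrite mule_ge0 ?ind_ge0 ?slab_ge0.
  - by rewrite lee_fin region_const_ge0// ltW.
have AG x : ind (0 <= x)%R * (ind (x <= s)%R *
    ((region_const m k a)%:E * slab (m - k) s (b - x ^+ 2 - k%:R * s ^+ 2)%R)) = A x.
  by rewrite /A muleA -ind_andb muleCA [(b - x ^+ 2 - _)%R]addrAC.
case: k @G G0 mG1 mG2 mG @A A0 mA AE AG => [|k] G G0 mG1 mG2 mG A A0 mA AE AG.
  transitivity (2%:E * \int[mu]_x A x).
    by congr (_ * _); apply: eq_integral => x _; rewrite /G /= mul0e adde0 AG.
  rewrite AE muleA; congr (_ * _); last by rewrite !subn0.
  by rewrite -EFinM /region_const !bin0 !mulrA -exprS.
(* The slices with [x > s], put in the form integrated by [integral_power]. *)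
pose B (x : R) : \bar R :=
  ((2 ^+ m * 'C(m, k)%:R / k`!%:R)%:E * slab (m - k) s (b - k.+1%:R * s ^+ 2)%R) *
  (ind (s < x < s + a)%R * ((s + a - x) ^+ k)%:E).
have mB' : measurable_fun setT (fun x : R =>
    (ind (s < x < s + a)%R * ((s + a - x) ^+ k)%:E)).
  apply: emeasurable_funM.
    by apply: measurable_ind; apply: measurable_and; exact: measurable_fun_ltr.
  by apply/measurable_EFinP; apply: measurable_funX; exact: measurable_funB.
have B'0 (x : R) : 0 <= ind (s < x < s + a)%R * ((s + a - x) ^+ k)%:E.
  rewrite /ind; case: (boolP (s < x < s + a)%R) => [/andP[_ xs]|_]; last by rewrite mul0e.
  by rewrite mul1e lee_fin exprn_ge0// subr_ge0 ltW.
have c0 : 0 <= (2 ^+ m * 'C(m, k)%:R / k`!%:R)%:E * slab (m - k) s (b - k.+1%:R * s ^+ 2)%R.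
  by rewrite mule_ge0 ?slab_ge0// lee_fin !mulr_ge0 ?exprn_ge0 ?invr_ge0.
have BE : \int[mu]_x B x =
  ((2 ^+ m * 'C(m, k)%:R / k`!%:R)%:E * slab (m - k) s (b - k.+1%:R * s ^+ 2)%R) *
  (a ^+ k.+1 / k.+1%:R)%:E.
  by rewrite ge0_integralZl// integral_power.
transitivity (2%:E * \int[mu]_x (A x + B x)).
  congr (_ * _); apply: eq_integral => x _; rewrite /G.
  rewrite ge0_muleDr; last 2 first.
    by rewrite !mule_ge0 ?ind_ge0 ?slab_ge0// lee_fin region_const_ge0// ltW.
    rewrite mule_ge0 ?ind_ge0//; have [a'0|] := ltP 0%R (a + s - x)%R; last by rewrite mul0e.
    by rewrite !mule_ge0 ?ind_ge0 ?slab_ge0// lee_fin region_const_ge0// ltW.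
  rewrite AG; congr (_ + _).
  rewrite muleA -ind_andb muleA -ind_andb /B.
  have -> : ((0 <= x) && ((0 < k.+1)%N && (s < x)) && (0 < a + s - x) =
      (s < x < s + a))%R.
    apply/idP/idP => [/andP[/andP[_ /andP[_ ->]]]|/andP[sx xa]] /=; first by lra.
    by rewrite sx andbT; apply/andP; split; lra.
  have -> : (b - s ^+ 2 - k%:R * s ^+ 2 = b - k.+1%:R * s ^+ 2)%R.
    by rewrite -natr1; ring.
  case: (s < x < s + a)%R; last by rewrite !mul0e mule0.
  rewrite !mul1e [RHS]muleAC -EFinM; congr (_%:E * _).
  by rewrite /region_const (addrC s a) /=; ring.
rewrite ge0_integralD//; last 2 first.
  by move=> x _; rewrite /B mule_ge0.
  exact: emeasurable_funM.
rewrite AE BE [X in _ + X]muleAC -EFinM subSS.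
have K0 : (k.+1%:R != 0 :> R)%R by rewrite pnatr_eq0.
have F0 : (k`!%:R != 0 :> R)%R by rewrite pnatr_eq0 -lt0n fact_gt0.
(* For [m <= k] the truncated subtraction spoils the slab dimension in the first term, but its
   coefficient ['C(m, k.+1)] is 0. *)
have [km|mk] := ltnP k m.
  rewrite subnSK// -ge0_muleDl; last 2 first.
    by rewrite lee_fin region_const_ge0// ltW.
    by rewrite lee_fin !mulr_ge0 ?exprn_ge0 ?invr_ge0// ltW.
  rewrite muleA -EFinD -EFinM; congr (_%:E * _).
  rewrite /region_const binS natrD factS natrM !exprS.
  by move: K0 F0; move: (k.+1%:R : R)%R (k`!%:R : R)%R => K F' K0 F0; field; rewrite K0 F0.
rewrite [X in X + _](_ : _ = 0); last by rewrite /region_const bin_small// !(mulr0, mul0r) mul0e.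
rewrite add0e muleA -EFinM; congr (_%:E * _).
rewrite /region_const binS natrD factS natrM !exprS (bin_small (_ : m < k.+1)%N)//.
by move: K0 F0; move: (k.+1%:R : R)%R (k`!%:R : R)%R => K F' K0 F0; field; rewrite K0 F0.
Qed.

End exceed_volume.

(** * The pieces of space over the faces *)

Section face_piece.
Context {R : realType}.
Notation RR := (measurableTypeR R).
Notation mu := (@lebesgue_measure R).

Lemma eq_threshold n (x y : 'I_n -> R) : (forall i, `|x i| = `|y i|) ->
  threshold x = threshold y.
Proof.
by move=> xy; apply: eq_bigr => J _; congr ((_ - 1) / _); apply: eq_bigr.
Qed.

Lemma eq_exceed_count n s (x y : 'I_n -> R) : (forall i, `|x i| = `|y i|) ->
  exceed_count s x = exceed_count s y.
Proof. by move=> xy; apply: eq_bigr => i _; rewrite xy. Qed.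

Lemma eq_trunc_sqnorm n s (x y : 'I_n -> R) : (forall i, `|x i| = `|y i|) ->
  trunc_sqnorm s x = trunc_sqnorm s y.
Proof. by move=> xy; apply: eq_bigr => i _; rewrite xy. Qed.

Lemma exceed_countE n s (x : 'I_n -> R) :
  exceed_count s x = #|finset (fun i => s < `|x i|)|.
Proof.
rewrite /exceed_count -sum1_card [RHS]big_mkcond/=.
by apply: eq_bigr => i _; rewrite finset.in_set; case: (s < _).
Qed.

(* The points whose projection onto the cross-polytope is in the relative
   interior of a [k]-dimensional face. *)
Definition face_piece n (k : nat) (b : R) (x : 'I_n -> R) : bool :=
  [&& 0 < threshold x, exceed_count (threshold x) x == k.+1 &
      trunc_sqnorm (threshold x) x <= b].

Lemma measurable_face_piece d (T : measurableType d) n k b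
    (g : T -> n.-tuple RR) : measurable_fun setT g ->
  measurable_fun setT (fun x => face_piece k b (tnth (g x))).
Proof.
move=> mg; have mt := measurable_threshold mg.
apply: measurable_and; first exact: measurable_fun_ltr.
apply: measurable_and; first exact: measurable_exceed_count_eq.
by apply: measurable_fun_ler => //; exact: measurable_trunc_sqnorm.
Qed.

Section fibre.
Variables (m k : nat) (i : 'I_m.+1) (b : R) (t : m.-tuple RR).

(** With the other coordinates [t] fixed, [V] is the part of the line in direction [i] where the
    point lies in the piece and coordinate [i] exceeds; [S] is the set of thresholds that occur
    there. *)
Let V (u : R) := face_piece k b (tnth (insert i u t)) &&
  (threshold (tnth (insert i u t)) < `|u|).

Let S (s : R) := (0 < s) && exceed_region k s 1 (b - s ^+ 2) t.

(** The value of coordinate [i] that brings the total excess at level [s] to exactly 1. *)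
Let F (s : R) := s + 1 - exceed_sum s (tnth t).

Lemma fibre_of_level s : S s -> 0 <= F s /\ V (F s).
Proof.
move=> /andP[s0 /and3P[/eqP ck e1 tb]].
have sF : s < F s by rewrite /F; lra.
have F0 : 0 <= F s by rewrite (le_trans (ltW s0))// ltW.
split=> //.
have tE : threshold (tnth (insert i (F s) t)) = s.
  apply: threshold_eq; first exact: ltW.
  rewrite exceed_sum_insert ger0_norm// max_l; last by rewrite subr_ge0 ltW.
  by rewrite /F; lra.
rewrite /V /face_piece tE ger0_norm// sF s0 andbT/= exceed_count_insert ck.
rewrite trunc_sqnorm_insert ger0_norm// sF add1n eqxx/= min_r; last exact: ltW.
by rewrite -lerBrDl.
Qed.

Lemma level_of_fibre u : 0 <= u -> V u ->
  let s := threshold (tnth (insert i u t)) in S s /\ F s = u.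
Proof.
move=> u0 /andP[/and3P[s0 ck tb] su] s.
rewrite -/s in s0 ck tb su; rewrite (ger0_norm u0) in su.
have := exceed_sum_threshold s0; rewrite -/s exceed_sum_insert ger0_norm//.
rewrite max_l; last by rewrite subr_ge0 ltW.
move=> e1; split; last by rewrite /F; lra.
rewrite /S s0 /exceed_region /=; apply/and3P; split.
- by move: ck; rewrite exceed_count_insert ger0_norm// su add1n eqSS.
- by lra.
- move: tb; rewrite trunc_sqnorm_insert ger0_norm// min_r; last exact: ltW.
  by rewrite lerBrDl.
Qed.

(** Raising the level can only shrink the exceeding set, and on [S] its cardinality is always
    [k]. *)
Lemma exceed_set_level s s' : S s -> S s' -> s <= s' ->
  finset (fun j => s' < `|tnth t j|) = finset (fun j => s < `|tnth t j|).
Proof.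
move=> /andP[_ /and3P[/eqP ck _ _]] /andP[_ /and3P[/eqP ck' _ _]] ss'.
apply/eqP; rewrite eqEcard -!exceed_countE ck ck' leqnn andbT.
by apply/fintype.subsetP => j; rewrite !finset.in_set; exact: le_lt_trans.
Qed.

(** As the same [k] coordinates exceed every level of [S], [exceed_sum] has slope [- k] on [S], and
    [F] has slope [k.+1]. *)
Lemma fibre_affine s s' : S s -> S s' -> F s' = F s + k.+1%:R * (s' - s).
Proof.
wlog ss' : s s' / s <= s'.
  move=> H Ss Ss'; have [ss'|s's] := leP s s'; first exact: H.
  by rewrite (H _ _ (ltW s's) Ss' Ss); ring.
move=> Ss Ss'; have E := exceed_set_level Ss Ss' ss'.
move: Ss Ss' => /andP[_ /and3P[/eqP ck _ _]] /andP[_ /and3P[/eqP ck' _ _]].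
rewrite /F !exceed_sumE E !sum_sub_card -exceed_countE ck -natr1; ring.
Qed.

Lemma measurable_fibre : measurable_fun setT V.
Proof.
have mi : measurable_fun [set: RR] (fun u : RR => insert i u t).
  by apply: measurable_insert.
apply: measurable_and; first exact: measurable_face_piece.
have mn : measurable_fun [set: RR] (fun u : RR => `|u : R|) by exact: normr_measurable.
by apply: measurable_fun_ltr => //; exact: measurable_threshold.
Qed.

Lemma fibre_measure :
  (mu [set u : R | ((0 <= u)%R && V u)] = k.+1%:R%:E * mu [set s : R | S s])%E.
Proof.
have [[s0 S0]|noS] := pselect (exists s, S s); last first.
  rewrite (_ : [set s | S s] = set0); last first.
    by rewrite -subset0 => s Ss; apply: noS; exists s.
  rewrite (_ : [set u | _] = set0) ?measure0 ?mule0//.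
  rewrite -subset0 => u /andP[u0 Vu].
  by apply: noS; eexists; exact: (level_of_fibre u0 Vu).1.
(* The affine map of slope [k.+1] through [(s0, F s0)] agrees with [F] on [S] and carries [S] onto
   the fibre. *)
rewrite (@lebesgue_measure_affine R k.+1%:R (F s0 - k.+1%:R * s0))//; last first.
  rewrite -[X in measurable X]setTI.
  have : measurable_fun [set: R] (fun u : R => (0 <= u) && V u).
    by apply: measurable_and; [exact: measurable_fun_ler|exact: measurable_fibre].
  by apply => //.
congr (_ * mu _)%E; apply/seteqP; split => s /=.
  rewrite addrCA -mulrBr => /andP[u0 Vu].
  have [Ss] := level_of_fibre u0 Vu.
  rewrite (fibre_affine S0 Ss) => /addrI.
  have k0 : k.+1%:R != 0 :> R by rewrite pnatr_eq0.
  by move=> /(mulfI k0)/addIr <-.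
move=> Ss; rewrite addrCA -mulrBr -(fibre_affine S0 Ss).
by have [-> ->] := fibre_of_level Ss.
Qed.

End fibre.

(** The volume of the [(s, x)] with [s > 0], [x] in [[0, s]^(m - k)] and
    [k.+1 * s ^ 2 + |x|^2 <= b]: each of the [k.+1] exceeding coordinates contributes [s ^ 2] to the
    squared distance. *)
Definition radial_slab (m k : nat) (b : R) : \bar R :=
  (\int[mu]_s (ind (0 < s)%R * slab (m - k) s (b - k.+1%:R * s ^+ 2)%R))%E.

End face_piece.

Section face_piece_volume.
Context {R : realType}.
Notation RR := (measurableTypeR R).
Notation mu := (@lebesgue_measure R).
Local Open Scope ereal_scope.

Lemma ge0_sum_cst n (X : \bar R) : 0 <= X -> \sum_(i < n) X = n%:R%:E * X.
Proof.
move=> X0; elim: n => [|n IH]; first by rewrite big_ord0 mul0e.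
by rewrite big_ord_recr/= IH -natr1 EFinD ge0_muleDl ?lee_fin ?mul1e.
Qed.

Lemma norm_insert_norm m (i : 'I_m.+1) (x : R) (t : m.-tuple RR) j :
  `|tnth (insert i x t) j|%R = `|tnth (insert i (`|x| : R)%R t) j|%R :> R.
Proof.
case: (unliftP i j) => [j'|] ->; first by rewrite !tnth_insert_lift.
by rewrite !tnth_insert_eq normr_id.
Qed.

(** The factor 2 comes from the sign of coordinate [i], and [k.+1] is the slope of the change of
    variables. *)
Lemma integral_fibre m k (i : 'I_m.+1) (b : R) (t : m.-tuple RR) :
  \int[mu]_x ind (face_piece k b (tnth (insert i x t)) &&
    (threshold (tnth (insert i x t)) < `|x|)%R) =
  (2 * k.+1%:R)%:E *
    \int[mu]_s ind ((0 < s)%R && exceed_region k s 1 (b - s ^+ 2)%R t).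
Proof.
pose V (x : R) := face_piece k b (tnth (insert i x t)) &&
    (threshold (tnth (insert i x t)) < `|x|)%R.
have mV : measurable_fun setT V by exact: measurable_fibre.
transitivity (\int[mu]_x ind (V `|x|%R)).
  apply: eq_integral => x _; congr ind; rewrite /V /face_piece normr_id.
  have E := norm_insert_norm i x t.
  by rewrite (eq_threshold E) (eq_exceed_count _ E) (eq_trunc_sqnorm _ E).
rewrite (@ge0_integral_even _ (fun x => ind (V x))); last 2 first.
- exact: measurable_ind.
- by move=> x; exact: ind_ge0.
rewrite EFinM -muleA; congr (_ * _).
rewrite (_ : [set` _] = [set x | 0 <= x]%R); last first.
  by apply/seteqP; split => x; rewrite /= in_itv/= andbT.
rewrite integral_ind_mul; under eq_integral do rewrite -ind_andb.
rewrite (@integral_ind _ _ RR mu); last first.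
  by apply: measurable_and => //; exact: measurable_fun_ler.
rewrite (@integral_ind _ _ RR mu); last first.
  apply: measurable_and; first exact: measurable_fun_ltr.
  apply: measurable_exceed_region => //.
  by apply: measurable_funB.
exact: fibre_measure.
Qed.

Lemma exceed_level_volume m k (b : R) :
  \int[lebesgue_tuple R m]_t
    \int[mu]_s ind ((0 < s)%R && exceed_region k s 1 (b - s ^+ 2)%R t) =
  (region_const m k 1)%:E * radial_slab m k b.
Proof.
pose f (p : RR * m.-tuple RR) : \bar R :=
  ind ((0 < p.1)%R && exceed_region k p.1 1 (b - p.1 ^+ 2)%R p.2).
have m1 : measurable_fun setT (fun p : RR * m.-tuple RR => p.1 : R).
  exact: measurable_fst.
have mf : measurable_fun setT f.
  apply: measurable_ind; apply: measurable_and; first exact: measurable_fun_ltr.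
  apply: measurable_exceed_region => //.
  by apply: measurable_funB => //; exact: measurable_funX.
have f0 p : 0 <= f p by exact: ind_ge0.
have := fubini_tonelli (m1 := mu) (m2 := lebesgue_tuple R m) f mf f0.
rewrite /f/= => <-.
transitivity (\int[mu]_s ((region_const m k 1)%:E *
    (ind (0 < s)%R * slab (m - k) s (b - k.+1%:R * s ^+ 2)%R))).
  apply: eq_integral => s _.
  have [s0|s0] := ltP 0%R s; last first.
    by rewrite mul0e mule0 integral0.
  rewrite /= mul1e exceed_region_volume ?ltW// ltr01 mul1e.
  by congr (_ * slab _ _ _); rewrite -natr1; ring.
rewrite ge0_integralZl//.
- apply: emeasurable_funM.
    by apply: measurable_ind; exact: measurable_fun_ltr.
  apply: measurable_slab => //; apply: measurable_funB => //.
  exact: measurable_funM.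
- by move=> s _; rewrite mule_ge0 ?ind_ge0 ?slab_ge0.
- by rewrite lee_fin region_const_ge0.
Qed.

(* Each of the [k.+1] coordinates exceeding the threshold may be singled out
   for the change of variables, whose Jacobian is [k.+1]. *)
Lemma face_piece_volume m k (b : R) :
  \int[lebesgue_tuple R m.+1]_t ind (face_piece k b (tnth t)) =
  (m.+1%:R * 2 * region_const m k 1)%:E * radial_slab m k b.
Proof.
pose L := \int[lebesgue_tuple R m.+1]_t ind (face_piece k b (tnth t)).
have mid : measurable_fun [set: m.+1.-tuple RR] id by exact: measurable_id.
have mp : measurable_fun [set: m.+1.-tuple RR]
  (fun t : m.+1.-tuple RR => face_piece k b (tnth t)).
  exact: (measurable_face_piece k b mid).
pose f (i : 'I_m.+1) (t : m.+1.-tuple RR) := face_piece k b (tnth t) &&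
    (threshold (tnth t) < `|tnth t i : R|)%R.
have mf i : measurable_fun setT (f i).
  apply: measurable_and => //; apply: measurable_fun_ltr.
    exact: (measurable_threshold mid).
  exact: (measurable_norm_tnth mid i).
(* The left side counts pairs of a point and one of its [k.+1] exceeding coordinates; this
   multiplicity cancels against the slope. *)
suff H : k.+1%:R%:E * L = k.+1%:R%:E *
    ((m.+1%:R * 2 * region_const m k 1)%:E * radial_slab m k b).
  have k0 : (k.+1%:R != 0 :> R)%R by rewrite pnatr_eq0.
  move: (congr1 (fun x => (k.+1%:R^-1)%:E * x) H).
  by rewrite ![(k.+1%:R^-1)%:E * _]muleA -!EFinM mulVf// !mul1e.
transitivity (\sum_(i < m.+1) \int[lebesgue_tuple R m.+1]_t ind (f i t)).
  rewrite -ge0_integral_sum//; last 2 first.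
  - by move=> i; exact: measurable_ind.
  - by move=> i t _; exact: ind_ge0.
  rewrite -ge0_integralZl//; last 2 first.
  - exact: measurable_ind.
  - by move=> t _; exact: ind_ge0.
  apply: eq_integral => t _; rewrite /f.
  have [|_] := boolP (face_piece k b (tnth t)); last by rewrite mule0 big1.
  move=> /and3P[_ /eqP ck _]; rewrite -ck/= /ind mule1 sumEFin; congr EFin.
  by rewrite /exceed_count natr_sum.
rewrite (eq_bigr (fun=> (2 * k.+1%:R)%:E * ((region_const m k 1)%:E * radial_slab m k b))).
  rewrite ge0_sum_cst; last first.
    rewrite !mule_ge0 ?lee_fin ?region_const_ge0//.
    by apply: integral_ge0 => s _; rewrite mule_ge0 ?ind_ge0 ?slab_ge0.
  by rewrite !muleA -!EFinM; congr (_%:E * _); ring.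
move=> i _; rewrite (tonelli_lebesgue_tuple i); last 2 first.
- exact: measurable_ind.
- by move=> t; exact: ind_ge0.
pose g (p : RR * m.-tuple RR) : \bar R := ind (f i (insert i p.1 p.2)).
have mg : measurable_fun setT g.
  apply: measurable_ind; apply: (measurableT_comp (mf i)).
  exact: measurable_insert.
have g0 p : 0 <= g p by exact: ind_ge0.
have := fubini_tonelli (m1 := mu) (m2 := lebesgue_tuple R m) g mg g0.
rewrite /g/= => ->.
pose h (p : RR * m.-tuple RR) : \bar R :=
  ind ((0 < p.1)%R && exceed_region k p.1 1 (b - p.1 ^+ 2)%R p.2).
have mh : measurable_fun setT h.
  have m1 : measurable_fun setT (fun p : RR * m.-tuple RR => p.1 : R).
    exact: measurable_fst.
  apply: measurable_ind; apply: measurable_and; first exact: measurable_fun_ltr.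
  apply: measurable_exceed_region => //.
  by apply: measurable_funB => //; exact: measurable_funX.
have h0 p : 0 <= h p by exact: ind_ge0.
rewrite -exceed_level_volume -ge0_integralZl//; last 2 first.
- by apply: (measurable_fun_fubini_tonelli_G h).
- by move=> t _; apply: integral_ge0 => s _; exact: ind_ge0.
apply: eq_integral => t _; rewrite /f; under eq_integral do rewrite tnth_insert_eq.
exact: integral_fibre.
Qed.

(** Dilating [s] and the [m - k] slab coordinates by [r] scales the bound by [r ^ 2]. *)
Lemma radial_slab_scale m k (r : R) : (k <= m)%N -> (0 <= r)%R ->
  radial_slab m k (r ^+ 2)%R = (r ^+ (m.+1 - k))%:E * radial_slab m k 1.
Proof.
move=> km r0; rewrite /radial_slab.
have mslab b : measurable_fun setT (fun s : R =>
    ind (0 < s)%R * slab (m - k) s (b - k.+1%:R * s ^+ 2)%R).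
  apply: emeasurable_funM.
    by apply: measurable_ind; exact: measurable_fun_ltr.
  apply: measurable_slab => //; apply: measurable_funB => //.
  by apply: measurable_funM => //; exact: exprn_measurable.
have slab0 b (s : R) : 0 <= ind (0 < s)%R * slab (m - k) s (b - k.+1%:R * s ^+ 2)%R.
  by rewrite mule_ge0 ?ind_ge0 ?slab_ge0.
(* At [r = 0] the exponent [m.+1 - k] is positive, and on the left [s > 0] makes the bound negative,
   so both sides vanish. *)
have [r00|rn0] := eqVneq r 0%R.
  rewrite r00 subSn// !expr0n/= mul0e; apply: integral0_eq => s _.
  have [s0|_] := ltP 0%R s; last by rewrite mul0e.
  by rewrite slab_lt0 ?mule0// sub0r oppr_lt0 mulr_gt0// exprn_gt0.
have {rn0}r0 : (0 < r)%R by rewrite lt_neqAle eq_sym rn0.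
rewrite (@ge0_integral_affine _ r 0)// subSn// [(r ^+ (m - k).+1)%R]exprS EFinM -muleA; congr (_ * _).
rewrite -ge0_integralZl//; last by rewrite lee_fin exprn_ge0// ltW.
apply: eq_integral => s _; rewrite addr0 pmulr_rgt0// muleCA; congr (_ * _).
  by rewrite -slab_scale//; congr slab; ring.
exact: mslab.
Qed.

(** If [s > 1] then [k.+1 * s ^ 2 > 1] and the slab is empty; otherwise its volume is at most 1. *)
Lemma radial_slab_fin m k : radial_slab m k (1 : R) \is a fin_num.
Proof.
rewrite ge0_fin_numE; last first.
  by apply: integral_ge0 => s _; rewrite mule_ge0 ?ind_ge0 ?slab_ge0.
apply: (@le_lt_trans _ _ (\int[mu]_x ind (0 <= x <= 1)%R)); last first.
  by rewrite integral_ind_itv// ltry.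
apply: ge0_le_integral => //.
- by move=> s _; rewrite mule_ge0 ?ind_ge0 ?slab_ge0.
- apply: emeasurable_funM; first by apply: measurable_ind; exact: measurable_fun_ltr.
  apply: measurable_slab => //; apply: measurable_funB => //.
  exact: measurable_funM.
- by apply: measurable_ind; apply: measurable_and; exact: measurable_fun_ler.
move=> s _; have [s0|s0] := ltP 0%R s; last by rewrite mul0e ind_ge0.
rewrite mul1e (ltW s0)/=; have [s1|s1] := leP s 1%R.
  by rewrite (le_trans (slab_le _ _ (ltW s0)))// lee_fin exprn_ile1// ltW.
rewrite slab_lt0//; rewrite subr_lt0 -natr1 mulrDl mul1r.
have : (1 < s ^+ 2)%R by rewrite exprn_egt1.
have : (0 <= k%:R * s ^+ 2)%R by rewrite mulr_ge0// sqr_ge0.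
by lra.
Qed.

End face_piece_volume.

(** * The Steiner polynomial *)

Section gamma.
Context {R : realType}.
Notation RR := (measurableTypeR R).
Notation mu := (@lebesgue_measure R).
Local Open Scope ereal_scope.

Let gam (j : nat) (t : R) : R := (t `^ (j%:R / 2) * expR (- t))%R.

Let measurable_gam j : measurable_fun setT (gam j).
Proof.
apply: measurable_funM; first exact: measurable_powR.
by apply: measurableT_comp => //; exact: measurableT_comp.
Qed.

Let gam_ge0 j t : (0 <= gam j t)%R.
Proof. by rewrite mulr_ge0 ?powR_ge0 ?expR_ge0. Qed.

Lemma integral_expR_half : \int[mu]_(t in `[0%R, +oo[) (expR (- (t / 2)))%:E = 2%:E.
Proof.
rewrite (_ : [set` _] = [set t | 0 <= t]%R); last first.
  by apply/seteqP; split => x; rewrite /= in_itv/= andbT.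
rewrite integral_ind_mul (@ge0_integral_affine _ 2 0)//; last 2 first.
- apply: emeasurable_funM; first by apply: measurable_ind; exact: measurable_fun_ler.
  apply/measurable_EFinP; apply: measurableT_comp => //; apply: measurableT_comp => //.
  exact: measurable_funM.
- by move=> x; rewrite mule_ge0 ?ind_ge0// lee_fin expR_ge0.
rewrite -[RHS]mule1 -(_ : \int[mu]_(t in `[0%R, +oo[) (expR (- t))%:E = 1); last first.
  by rewrite integral_expRN oppr0 expR0.
rewrite (_ : [set` _] = [set t | 0 <= t]%R); last first.
  by apply/seteqP; split => x; rewrite /= in_itv/= andbT.
rewrite integral_ind_mul; congr (_ * _); apply: eq_integral => x _.
by rewrite addr0 pmulr_rge0// mulrAC divff// mul1r.
Qed.

(** One factor [e^(- t / 2)] absorbs the power, by [(t / 2) ^ j / j! <= e^(t / 2)]; the other is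
    left for integrability. *)
Lemma gam_le j (t : R) : (0 <= t)%R ->
  (gam j t <= (1 + 2 ^+ j * j`!%:R) * expR (- (t / 2)))%R.
Proof.
move=> t0.
have tj : (t ^+ j <= 2 ^+ j * j`!%:R * expR (t / 2))%R.
  have e0 : (0 <= t / 2)%R by rewrite divr_ge0.
  case: j => [|j]; first by rewrite expr0 mul1r (_ : 0`! = 1%N)// mul1r -[X in (X <= _)%R]expR0 ler_expR.
  have := @expR_ge1Dxn R _ j e0.
  have f0 : (0 < j.+1`!%:R :> R)%R by rewrite ltr0n fact_gt0.
  rewrite expr_div_n => h.
  have : (t ^+ j.+1 / 2 ^+ j.+1 / j.+1`!%:R <= expR (t / 2))%R by lra.
  by rewrite !ler_pdivrMr ?exprn_gt0// => /le_trans; apply; rewrite mulrC mulrA mulrAC mulrC mulrA.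
have pj : (t `^ (j%:R / 2) <= 1 + t ^+ j)%R.
  have [t1|t1] := leP t 1%R.
    rewrite (@le_trans _ _ 1%R)//; last by rewrite lerDl exprn_ge0.
    rewrite -[leRHS](_ : 1 `^ (j%:R / 2) = 1)%R; last by rewrite powR1.
    by rewrite ge0_ler_powR// ?nnegrE// divr_ge0.
  rewrite (@le_trans _ _ (t ^+ j)%R)//; last by rewrite lerDr.
  rewrite -powR_mulrn// ler_powR// ?(ltW t1)//.
  by rewrite ler_pdivrMr// ler_peMr// ler1n.
have E : (expR (- t) = expR (- (t / 2)) * expR (- (t / 2)))%R.
  by rewrite -expRD; congr expR; lra.
have e1 : (expR (- (t / 2)) <= 1)%R by rewrite -[leRHS]expR0 ler_expR; lra.
have e0 : (0 < expR (- (t / 2)))%R by rewrite expR_gt0.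
have e2 : (expR (t / 2) * expR (- (t / 2)) = 1)%R by rewrite -expRD subrr expR0.
rewrite /gam E mulrA ler_wpM2r ?(ltW e0)//.
apply: (@le_trans _ _ ((1 + t ^+ j) * expR (- (t / 2)))%R).
  by rewrite ler_wpM2r// ltW.
rewrite mulrDl mul1r lerD// (le_trans (ler_wpM2r (ltW e0) tj))//.
by rewrite -(mulrA _ (expR _)) e2 mulr1.
Qed.

(** [Gamma] is a real-valued integral, which would read 0 if the integral were infinite; hence
    finiteness is settled in [\bar R]. Positivity comes from [[1, 2]], where the integrand is at
    least [e^(- 2)]. *)
Lemma integral_gam_bounds j : exists2 c : R, (0 < c)%R &
  \int[mu]_(t in `]0%R, +oo[) (gam j t)%:E = c%:E.
Proof.
set I := \int[mu]_(t in _) _.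
have I_fin : I < +oo.
  rewrite /I integral_itv_obnd_cbnd; last first.
    by apply/measurable_EFinP; apply: measurable_funTS; exact: measurable_gam.
  apply: (@le_lt_trans _ _ (\int[mu]_(t in `[0%R, +oo[)
      ((1 + 2 ^+ j * j`!%:R)%:E * (expR (- (t / 2)))%:E))).
    apply: ge0_le_integral => //.
    - by move=> t _; rewrite lee_fin.
    - by apply/measurable_EFinP; apply: measurable_funTS; exact: measurable_gam.
    - apply: emeasurable_funM => //; apply/measurable_EFinP.
      apply: measurableT_comp => //; apply: measurableT_comp => //.
      exact: measurable_funM.
    - move=> t; rewrite /= in_itv/= andbT => t0; rewrite lee_fin; exact: gam_le.
  rewrite ge0_integralZl//; first by rewrite integral_expR_half -EFinM ltry.
  - apply/measurable_EFinP; apply: measurableT_comp => //.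
    apply: measurableT_comp => //; exact: measurable_funM.
have I_gt0 : 0 < I.
  apply: (@lt_le_trans _ _ (\int[mu]_(t in `[1%R, 2%R]) (expR (- 2))%:E)).
    rewrite integral_cst// [X in _ * X](lebesgue_measure_itv `[(1 : R), 2]%R)/=.
    by rewrite lte_fin ltr1n -EFinB mule_gt0// lte_fin ?expR_gt0//; lra.
  apply: (@le_trans _ _ (\int[mu]_(t in `[1%R, 2%R]) (gam j t)%:E)).
    apply: ge0_le_integral => //.
    - by apply/measurable_EFinP; apply: measurable_funTS; exact: measurable_gam.
    - move=> t; rewrite /= in_itv/= => /andP[t1 t2]; rewrite lee_fin /gam.
      rewrite -[leLHS]mul1r ler_pM ?expR_ge0 ?ler01//; last by rewrite ler_expR; lra.
      by rewrite -[leLHS](powRr0 t) ler_powR// divr_ge0.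
  apply: ge0_subset_integral => //.
  - by apply/measurable_EFinP; apply: measurable_funTS; exact: measurable_gam.
  - by move=> t _; rewrite lee_fin.
  - by move=> t; rewrite /= !in_itv/= andbT => /andP[t1 _]; lra.
exists (fine I); first by rewrite fine_gt0// I_gt0.
by rewrite fineK// ge0_fin_numE// ltW.
Qed.

Lemma Gamma_half_gt0 j : (0 < Gamma (j%:R / 2 + 1 : R))%R.
Proof.
have [c c0 E] := integral_gam_bounds j.
rewrite /Gamma /Rintegral addrK.
by rewrite (_ : integral _ _ _ = c%:E).
Qed.

Lemma Gamma_halfE j :
  \int[mu]_u (ind (0 <= u)%R * (gam j u)%:E) = (Gamma (j%:R / 2 + 1 : R))%:E.
Proof.
have [c c0 E] := integral_gam_bounds j.
rewrite /Gamma /Rintegral addrK [in RHS](_ : integral _ _ _ = c%:E)//= -E.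
rewrite integral_itv_obnd_cbnd; last first.
  by apply/measurable_EFinP; apply: measurable_funTS; exact: measurable_gam.
rewrite (_ : [set` _] = [set t | 0 <= t]%R) ?integral_ind_mul//.
by apply/seteqP; split => x; rewrite /= in_itv/= andbT.
Qed.

(* Up to a constant, the external angle of the cross-polytope at a [k]-face. *)
Definition face_integral (m k : nat) : \bar R :=
  \int[mu]_s (ind (0 < s)%R *
    (expR (- (k.+1%:R * s ^+ 2) / 2) * gauss_int s ^+ (m - k))%:E).

(** Tonelli over [(u, s)]: integrating in [u] first gives [face_integral] by [layer_cake];
    integrating in [s] first gives [radial_slab] at [2 u], whose homogeneity leaves a Gamma integral
    in [u]. *)
Lemma face_integralE m k : (k <= m)%N ->
  face_integral m k =
  radial_slab m k 1 *
    (2 `^ ((m.+1 - k)%:R / 2) * Gamma ((m.+1 - k)%:R / 2 + 1))%:E.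
Proof.
move=> km; set j := (m.+1 - k)%N.
pose F (p : RR * RR) : \bar R := ind (0 <= p.1)%R * (expR (- p.1))%:E *
  (ind (0 < p.2)%R * slab (m - k) p.2 (2 * p.1 - k.+1%:R * p.2 ^+ 2)%R).
have mF : measurable_fun setT F.
  have mp1 : measurable_fun setT (fun p : RR * RR => p.1 : R) by exact: measurable_fst.
  have mp2 : measurable_fun setT (fun p : RR * RR => p.2 : R) by exact: measurable_snd.
  apply: emeasurable_funM; apply: emeasurable_funM.
  - by apply: measurable_ind; exact: measurable_fun_ler.
  - by apply/measurable_EFinP; apply: measurableT_comp => //; exact: measurableT_comp.
  - by apply: measurable_ind; exact: measurable_fun_ltr.
  - apply: measurable_slab => //; apply: measurable_funB.
      exact: measurable_funM.
    by apply: measurable_funM => //; exact: measurable_funX.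
have F0 p : 0 <= F p.
  by rewrite /F !mule_ge0 ?ind_ge0 ?slab_ge0// lee_fin expR_ge0.
have /esym := fubini_tonelli (m1 := mu) (m2 := mu) F mF F0.
rewrite [X in X = _ -> _](_ : _ = face_integral m k); last first.
  apply: eq_integral => s _; rewrite /F/=.
  under eq_integral do rewrite muleCA.
  rewrite ge0_integralZl ?ind_ge0//.
  - by rewrite layer_cake// mulr_ge0// sqr_ge0.
  - apply: emeasurable_funM.
      apply: emeasurable_funM; first by apply: measurable_ind; exact: measurable_fun_ler.
      by apply/measurable_EFinP; apply: measurableT_comp => //; exact: measurableT_comp.
    by apply: measurable_slab => //; apply: measurable_funB.
  - by move=> u _; rewrite !mule_ge0 ?ind_ge0 ?slab_ge0// lee_fin expR_ge0.
move=> ->.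
transitivity (\int[mu]_u (radial_slab m k 1 * (2 `^ (j%:R / 2))%:E *
    (ind (0 <= u)%R * (gam j u)%:E))).
  apply: eq_integral => u _; rewrite /F/=.
  rewrite ge0_integralZl ?mule_ge0 ?ind_ge0 ?lee_fin ?expR_ge0//; last 2 first.
  - apply: emeasurable_funM; first by apply: measurable_ind; exact: measurable_fun_ltr.
    apply: measurable_slab => //; apply: measurable_funB => //.
    by apply: measurable_funM => //; exact: exprn_measurable.
  - by move=> s _; rewrite !mule_ge0 ?ind_ge0 ?slab_ge0.
  have [u0|u0] := leP 0%R u; last by rewrite !mul0e mule0.
  rewrite -[X in _ * X]/(radial_slab m k (2 * u)%R).
  have u20 : (0 <= 2 * u)%R by rewrite mulr_ge0.
  rewrite -[(2 * u)%R]sqr_sqrtr// radial_slab_scale// ?sqrtr_ge0//.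
  rewrite -powR12_sqrt// -/j -powR_mulrn ?powR_ge0// -powRrM powRM//.
  rewrite !mul1e muleA -EFinM muleC -[RHS]muleA -EFinM; congr (_ * _%:E).
  by rewrite /gam (mulrC 2^-1%R); ring.
rewrite ge0_integralZl//; last 3 first.
- apply: emeasurable_funM; first by apply: measurable_ind; exact: measurable_fun_ler.
  by apply/measurable_EFinP; exact: measurable_gam.
- by move=> u _; rewrite mule_ge0 ?ind_ge0// lee_fin.
- rewrite mule_ge0 ?lee_fin ?powR_ge0//.
  by apply: integral_ge0 => s _; rewrite mule_ge0 ?ind_ge0 ?slab_ge0.
by rewrite Gamma_halfE EFinM muleA.
Qed.

End gamma.

Section steiner.
Context {R : realType}.
Notation RR := (measurableTypeR R).
Notation mu := (@lebesgue_measure R).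

Lemma poly_coef_eq n (c d : nat -> R) :
  (forall r : R, 0 <= r -> \sum_(k < n) c k * r ^+ k = \sum_(k < n) d k * r ^+ k) ->
  forall k, (k < n)%N -> c k = d k.
Proof.
move=> cd k kn; pose p : {poly R} := \poly_(i < n) (c i - d i).
suff : p`_k = 0 by rewrite coef_poly kn => /eqP; rewrite subr_eq0 => /eqP.
suff -> : p = 0 by rewrite coef0.
(* The naturals [0, ..., n] are nonnegative and outnumber the possible roots. *)
apply: (@roots_geq_poly_eq0 _ p [seq i%:R | i <- iota 0 n.+1]).
- apply/allP => _ /mapP[i _ ->]; rewrite rootE horner_poly.
  by under eq_bigr do rewrite mulrBl; rewrite sumrB cd// subrr.
- rewrite map_inj_uniq ?iota_uniq// => i j /eqP.
  by rewrite eqr_nat => /eqP.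
- by rewrite size_map size_iota (leq_trans (size_poly _ _)).
Qed.

Lemma ball_volume_gt0 k : 0 < ball_volume k :> R.
Proof. by rewrite divr_gt0 ?Gamma_half_gt0// powR_gt0// pi_gt0. Qed.

(** The coefficient of [r ^ (n - k)] is [ball_volume (n - k) * V k], and ball volumes are
    nonzero. *)
Lemma steiner_formula_unique n (T : set 'rV[R]_n) (V V' : nat -> R) :
  steiner_formula T V -> steiner_formula T V' ->
  forall k, (k <= n)%N -> V k = V' k.
Proof.
move=> sV sV' k kn.
have H r : 0 <= r ->
    \sum_(j < n.+1) (ball_volume j * V (n - j)%N) * r ^+ j =
    \sum_(j < n.+1) (ball_volume j * V' (n - j)%N) * r ^+ j.
  move=> r0; have := sV r r0; rewrite (sV' r r0) => -[E].
  rewrite [LHS](reindex_inj rev_ord_inj)/= [RHS](reindex_inj rev_ord_inj)/=.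
  under eq_bigr do rewrite subSS subKn -1?ltnS//.
  under [RHS]eq_bigr do rewrite subSS subKn -1?ltnS//.
  by rewrite E.
have := @poly_coef_eq n.+1 (fun j => ball_volume j * V (n - j)%N)
  (fun j => ball_volume j * V' (n - j)%N) H (n - k)%N.
rewrite ltnS leq_subr => /(_ isT).
by rewrite subKn// => /mulfI; apply; rewrite gt_eqF ?ball_volume_gt0.
Qed.

Section cross_polytope.
Variable m : nat.
Notation lam := (lebesgue_tuple R m.+1).

(** The parallel body is split into the polytope, where the threshold is 0, and the face pieces: a
    point with positive threshold and [c] exceeding coordinates belongs to the piece of index
    [c.-1]. *)
Lemma volume_parallel_body (r : R) : 0 <= r ->
  volume [set x + r *: y | x in cross_polytope R m.+1 & y in unit_ball] =
  (lam [set t | (threshold (tnth t : _ -> R) <= 0)%R] +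
   \sum_(k < m.+1) (m.+1%:R * 2 * region_const m k 1 * fine (radial_slab m k (1 : R)) *
      r ^+ (m.+1 - k))%:E)%E.
Proof.
move=> r0; rewrite cross_polytope_parallel_body// /volume.
have mid : measurable_fun [set: m.+1.-tuple RR] id by exact: measurable_id.
have mt := measurable_threshold mid.
have mp k : measurable_fun [set: m.+1.-tuple RR]
  (fun t : m.+1.-tuple RR => face_piece k (r ^+ 2) (tnth t)).
  exact: (measurable_face_piece k _ mid).
have -> : [set t : m.+1.-tuple R | trunc_sqnorm (threshold ((\row_i tnth t i) 0))
    ((\row_i tnth t i) 0) <= r ^+ 2] =
  [set t : m.+1.-tuple R | (trunc_sqnorm (threshold (tnth t)) (tnth t) <= r ^+ 2)%R].
  apply/seteqP; split => t /=;
   by have -> : (\row_i tnth t i) 0 = tnth t by apply/funext => i; rewrite mxE.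
rewrite -integral_ind; last first.
  by apply: measurable_fun_ler => //; exact: (measurable_trunc_sqnorm mt mid).
rewrite -integral_ind; last exact: measurable_fun_ler.
rewrite (eq_bigr (fun k : 'I_m.+1 => \int[lam]_t ind (face_piece k (r ^+ 2) (tnth t)))%E); last first.
  move=> k _; rewrite face_piece_volume radial_slab_scale//; last by rewrite -ltnS.
  rewrite [in RHS]muleC -[in RHS](fineK (radial_slab_fin m k)) -!EFinM.
  by congr (_%:E); ring.
rewrite -ge0_integral_sum//; last 2 first.
- by move=> k; exact: measurable_ind.
- by move=> k t _; exact: ind_ge0.
rewrite -ge0_integralD//; last 4 first.
- by move=> t _; exact: ind_ge0.
- by apply: measurable_ind; exact: measurable_fun_ler.
- by move=> t _; apply: sume_ge0 => k _; exact: ind_ge0.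
- by apply: emeasurable_sum => k; exact: measurable_ind.
apply: eq_integral => t _; have [t0|t0] := ltP 0 (threshold (tnth t)); last first.
  have tE : threshold (tnth t) = 0 by apply/eqP; rewrite eq_le t0 threshold_ge0.
  rewrite big1 ?adde0 => [|k _]; last by rewrite /face_piece tE ltxx.
  rewrite tE /trunc_sqnorm big1 ?sqr_ge0// => j _.
  by rewrite min_r// expr0n.
rewrite add0e; set s := threshold _; set c := exceed_count s (tnth t).
have c0 : (0 < c)%N by exact: exceed_count_threshold_gt0.
have cm : (c.-1 < m.+1)%N by rewrite prednK// exceed_count_le.
rewrite (bigD1 (Ordinal cm))//= big1 ?adde0 => [|k].
  by rewrite /face_piece t0/= prednK// eqxx.
move=> kc; rewrite /face_piece -/s -/c t0/= -(prednK c0) eqSS.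
by rewrite eq_sym; move: kc => /negPf; rewrite -val_eqE /= => ->.
Qed.

(** The polytope lies in the cube [[-1, 1]^(m.+1)]; finiteness makes the constant Steiner
    coefficient a real number. *)
Lemma cross_polytope_volume_fin :
  lam [set t | threshold (tnth t : _ -> R) <= 0] \is a fin_num.
Proof.
have mid : measurable_fun [set: m.+1.-tuple RR] id by exact: measurable_id.
have mt := measurable_threshold mid.
rewrite ge0_fin_numE; last exact: measure_ge0.
apply: (@le_lt_trans _ _ (lam (box (fun=> centered_itv 1)))).
  apply: le_measure; rewrite ?inE.
  - rewrite -[X in measurable X]setTI.
    have : measurable_fun [set: m.+1.-tuple RR] (fun t : m.+1.-tuple RR => threshold (tnth t : _ -> R) <= 0).
      exact: measurable_fun_ler.
    by apply.
  - by apply: measurable_box => _; exact: measurable_itv.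
  move=> t /=; rewrite threshold_le// => e1 i.
  rewrite /centered_itv/= in_itv/= -ler_norml (le_trans _ e1)//.
  rewrite /exceed_sum (bigD1 i)//= subr0 max_l// lerDl sumr_ge0//.
rewrite lebesgue_tuple_box => [|_]; last exact: measurable_itv.
rewrite -ge0_fin_numE ?prode_ge0// prode_fin_num// => j _.
by rewrite ge0_fin_numE// lebesgue_centered_itv.
Qed.

Lemma cross_polytope_steiner : exists2 V, steiner_formula (cross_polytope R m.+1) V &
  forall k, (k <= m)%N -> V k = m.+1%:R * 2 * region_const m k 1 *
    fine (radial_slab m k (1 : R)) / ball_volume (m.+1 - k).
Proof.
pose V k : R := if (k <= m)%N then m.+1%:R * 2 * region_const m k 1 *
    fine (radial_slab m k (1 : R)) / ball_volume (m.+1 - k) else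
   fine (lam [set t | threshold (tnth t : _ -> R) <= 0]) / ball_volume 0.
exists V; last by move=> k km; rewrite /V km.
move=> r r0; rewrite volume_parallel_body// [in RHS]big_ord_recr/= subnn expr0 mulr1.
have -> : V m.+1 = fine (lam [set t | threshold (tnth t : _ -> R) <= 0]) /
    ball_volume 0 by rewrite /V ltnn.
rewrite [ball_volume 0 * _]mulrC divfK ?gt_eqF ?ball_volume_gt0//.
rewrite EFinD fineK ?cross_polytope_volume_fin// addeC; congr (_ + _)%E.
rewrite sumEFin; congr EFin; apply: eq_bigr => k _.
rewrite /V -ltnS ltn_ord; congr (_ * _).
by rewrite [RHS]mulrC divfK// gt_eqF ?ball_volume_gt0.
Qed.

Lemma intrinsic_volume_cross_polytope k : (k <= m)%N ->
  (intrinsic_volume k (cross_polytope R m.+1))%:E =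
  ((m.+1%:R * 2 * region_const m k 1 * (2 * pi) `^ (- ((m.+1 - k)%:R / 2)))%:E *
    face_integral m k)%E.
Proof.
move=> km; have [V sV VE] := cross_polytope_steiner.
rewrite /intrinsic_volume.
have := @xgetPex _ (fun=> 0) [set V | steiner_formula (cross_polytope R m.+1) V] (ex_intro _ V sV).
(* [xget] may choose a function other than [V], but they agree at indices up to [m.+1]. *)
move=> /= /steiner_formula_unique/(_ sV k (leqW km)) ->.
rewrite VE// face_integralE// -(fineK (radial_slab_fin m k)) -!EFinM; congr EFin.
rewrite /ball_volume powRN powRM ?pi_ge0//.
set j := (_ / 2); set a := region_const _ _ _; set w := fine _.
have p1 : pi `^ j != 0 :> R by rewrite gt_eqF// powR_gt0// pi_gt0.
have p2 : 2 `^ j != 0 :> R by rewrite gt_eqF// powR_gt0.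
have g0 : Gamma (j + 1) != 0 :> R by rewrite gt_eqF// Gamma_half_gt0.
have -> : fine (radial_slab m k 1) = w by [].
by field; rewrite p1 p2 g0.
Qed.

End cross_polytope.
End steiner.

(** * Gaussian measures on tuples *)

Section gaussian.
Context {R : realType}.
Notation RR := (measurableTypeR R).
Notation mu := (@lebesgue_measure R).
Notation gamma1 := (@normal_prob R 0 1).
Local Open Scope ereal_scope.

Lemma integral_ind_lt_norm (a : R) : (0 <= a)%R ->
  \int[mu]_u ind ((0 <= u)%R && (u < a)%R) = a%:E.
Proof.
move=> a0; rewrite (@integral_ind _ _ RR mu); last first.
  apply: measurable_and; first exact: measurable_fun_ler.
  exact: measurable_fun_ltr.
rewrite (_ : [set x | _] = [set` `[0%R, a[%R]).
  rewrite [LHS](lebesgue_measure_itv `[0%R, a[)/= lte_fin.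
  by move: a0; rewrite le_eqVlt => /predU1P[<-|->]; rewrite ?ltxx// -EFinB subr0.
by apply/seteqP; split => x; rewrite /= in_itv.
Qed.

(** The density describes [normal_prob] on sets. Writing [f x] as the length of [[0, f x[] reduces
    the integral to sets, and Tonelli on each side restores [f]. *)
Lemma integral_normal_prob (f : R -> R) : measurable_fun setT f ->
  (forall x, 0 <= f x)%R ->
  \int[gamma1]_x (f x)%:E = \int[mu]_x (f x * normal_pdf 0 1 x)%:E.
Proof.
move=> mf f0.
pose b (p : RR * RR) := (0 <= p.2)%R && (p.2 < f p.1)%R.
have m2 : measurable_fun setT (fun p : RR * RR => p.2 : R) by exact: measurable_snd.
have mf1 : measurable_fun setT (fun p : RR * RR => f p.1).
  by apply: measurableT_comp => //; exact: measurable_fst.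
have mb : measurable_fun setT b.
  by apply: measurable_and; [exact: measurable_fun_ler|exact: measurable_fun_ltr].
have mpdf : measurable_fun setT (fun p : RR * RR => normal_pdf 0 1 p.1 : R).
  by apply: measurableT_comp => //; exact: measurable_normal_pdf.
transitivity (\int[gamma1]_x \int[mu]_u ind (b (x, u))).
  by apply: eq_integral => x _; rewrite /b/= integral_ind_lt_norm.
have mI : measurable_fun setT (fun p : RR * RR => ind (b p) : \bar R) by exact: measurable_ind.
have I0 p : 0 <= (ind (b p) : \bar R) by exact: ind_ge0.
rewrite (fubini_tonelli (m1 := gamma1) (m2 := mu) (fun p => ind (b p) : \bar R) mI I0).
pose G (p : RR * RR) := ind (b p) * (normal_pdf 0 1 p.1)%:E.
have mG : measurable_fun setT G.
  by apply: emeasurable_funM => //; exact/measurable_EFinP.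
have G0 p : 0 <= G p by rewrite mule_ge0 ?ind_ge0// lee_fin normal_pdf_ge0.
transitivity (\int[mu]_u \int[mu]_x G (x, u)).
  apply: eq_integral => u _; rewrite /G.
  rewrite -(@integral_ind_mul _ _ RR mu (fun x => b (x, u))).
  rewrite (@integral_ind _ _ RR gamma1)//.
  apply: measurableT_comp => //; exact: measurable_fun_pair.
rewrite -(fubini_tonelli (m1 := mu) (m2 := mu) G mG G0).
apply: eq_integral => x _; rewrite /G /b/= ge0_integralZr//.
- by rewrite integral_ind_lt_norm// EFinM.
- apply: measurable_ind; apply: measurable_and; first exact: measurable_fun_ler.
  exact: measurable_fun_ltr.
- by move=> u _; exact: ind_ge0.
- by rewrite lee_fin normal_pdf_ge0.
Qed.

Definition normal_const : R := (Num.sqrt (2 * pi))^-1.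

Lemma normal_const_gt0 : (0 < normal_const)%R.
Proof. by rewrite invr_gt0 sqrtr_gt0 mulr_gt0// pi_gt0. Qed.

Lemma normal_pdf01E (x : R) :
  normal_pdf 0 1 x = (normal_const * expR (- x ^+ 2 / 2))%R.
Proof.
rewrite normal_pdfE// /normal_peak /normal_fun subr0 expr1n mul1r mulr2n.
by rewrite /normal_const mulr_natl [in RHS]mulr2n.
Qed.

Lemma integral_normal_prob_norm (f : R -> R) : measurable_fun setT f ->
  (forall x, 0 <= f x)%R ->
  \int[gamma1]_x (f `|x|)%:E = (2 * normal_const)%:E *
    \int[mu]_x (ind (0 <= x)%R * (f x * expR (- x ^+ 2 / 2))%:E).
Proof.
move=> mf f0.
have mn : measurable_fun setT (fun x : R => f `|x|%R) by exact: measurableT_comp.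
have mg : measurable_fun setT (fun x : R => expR (- x ^+ 2 / 2)).
  by apply: continuous_measurable_fun; exact: continuous_gauss.
rewrite integral_normal_prob//.
pose g (x : R) := (normal_const * (f x * expR (- x ^+ 2 / 2)))%:E.
have mg' : measurable_fun setT g.
  by apply/measurable_EFinP; apply: measurable_funM => //; exact: measurable_funM.
have g0 x : 0 <= g x.
  by rewrite lee_fin !mulr_ge0 ?expR_ge0// ltW// normal_const_gt0.
transitivity (\int[mu]_x g `|x|%R).
  apply: eq_integral => x _; rewrite /g normal_pdf01E real_normK ?num_real//.
  by congr EFin; ring.
rewrite ge0_integral_even// EFinM -muleA; congr (_ * _).
rewrite (_ : [set` _] = [set x | 0 <= x]%R); last first.
  by apply/seteqP; split => x; rewrite /= in_itv/= andbT.
rewrite integral_ind_mul -ge0_integralZl//.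
- by apply: eq_integral => x _; rewrite /g EFinM muleCA.
- apply: emeasurable_funM; first by apply: measurable_ind; exact: measurable_fun_ler.
  by apply/measurable_EFinP; exact: measurable_funM.
- by move=> x _; rewrite mule_ge0 ?ind_ge0// lee_fin mulr_ge0 ?expR_ge0.
- by rewrite lee_fin ltW// normal_const_gt0.
Qed.

Definition normal_mass (u : R) : R := (2 * normal_const * gauss_int u)%R.

(** The flag [C] carries the strict and the weak inequality together through the conditioning on the
    maximum. *)
Lemma normal_norm_lteif (C : bool) (u : R) :
  \int[gamma1]_x ind (`|x| < u ?<= if C)%R = (normal_mass u)%:E.
Proof.
have mC : measurable_fun setT (fun x : R => (x < u ?<= if C)%R).
  by case: C; [exact: measurable_fun_ler|exact: measurable_fun_ltr].
rewrite (@integral_normal_prob_norm (fun x => (nat_of_bool (x < u ?<= if C)%R)%:R))//; last first.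
  rewrite (_ : (fun x => _) = (fun x => if (x < u ?<= if C)%R then 1 else 0)%R).
    exact: measurable_fun_ifT.
  by apply/funext => x; case: (_ < _ ?<= if _)%R.
rewrite /normal_mass [in RHS]EFinM; congr (_ * _).
transitivity (\int[mu]_(x in [set x : R | (0 <= x)%R && (x < u ?<= if C)%R])
    (expR (- x ^+ 2 / 2))%:E).
  rewrite (@integral_ind_mul _ _ RR mu); apply: eq_integral => x _.
  by rewrite ind_andb -muleA; congr (_ * _); rewrite EFinM.
have cg : continuous (fun x : R => expR (- x ^+ 2 / 2)) by exact: continuous_gauss.
rewrite gauss_intE -(@integral_ind_mul _ _ RR mu).
case: C {mC} => //=.
rewrite (_ : [set x : R | (0 <= x < u)%R] = [set` `[0%R, u[%R]); last first.
  by apply/seteqP; split => x; rewrite /= in_itv.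
rewrite (_ : [set x : R | (0 <= x <= u)%R] = [set` `[0%R, u]%R]); last first.
  by apply/seteqP; split => x; rewrite /= in_itv.
rewrite integral_itv_bndo_bndc//; apply/measurable_EFinP; apply: measurable_funTS.
exact: continuous_measurable_fun.
Qed.

End gaussian.

Section gaussian_tuple.
Context {R : realType}.
Notation RR := (measurableTypeR R).
Notation mu := (@lebesgue_measure R).
Notation gamma1 := (@normal_prob R 0 1).
Local Open Scope ereal_scope.

Definition insert0 n (p : RR * n.-tuple RR) : n.+1.-tuple RR :=
  insert ord0 p.1 p.2.

Lemma measurable_insert0 n : measurable_fun setT (@insert0 n).
Proof. exact: measurable_insert. Qed.

HB.instance Definition _ n := isMeasurableFun.Build _ _ _ _ (@insert0 n)
  (@measurable_insert0 n).

(** Conditioning on one coordinate requires a law for the remaining ones; presenting it as a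
    distribution lets the probability structure be inferred. *)
Fixpoint gaussian_tuple n : probability (n.-tuple RR) R :=
  if n is n'.+1 then
    distribution ((gamma1 : probability RR R) \x gaussian_tuple n') (@insert0 n')
  else \d_([tuple] : 0.-tuple RR).

Lemma gaussian_tuple_box n (A : 'I_n -> set RR) :
  (forall i, measurable (A i)) ->
  gaussian_tuple n (box A) = \prod_(i < n) gamma1 (A i).
Proof.
elim: n A => [|n IH] A mA.
  by rewrite big_ord0 /= diracE mem_set// => -[].
rewrite big_ord_recl -IH// -product_measure1E//; last exact: measurable_box.
rewrite /= /distribution /pushforward; congr (_ _).
apply/seteqP; split => -[x t]; rewrite /insert0 /=.
  move=> /= tA; split; first by have := tA ord0; rewrite tnth_insert_eq.
  by move=> j; have := tA (lift ord0 j); rewrite tnth_insert_lift.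
move=> [xA tA] j; case: (unliftP ord0 j) => [k|] ->.
  by rewrite tnth_insert_lift; exact: tA.
by rewrite tnth_insert_eq.
Qed.

Lemma tonelli_gaussian m (M : {measure set (m.+1.-tuple RR) -> \bar R})
    (i : 'I_m.+1) (f : m.+1.-tuple RR -> \bar R) :
  (forall A, (forall i, measurable (A i)) ->
    M (box A) = (\prod_j gamma1 (A j))%E) ->
  measurable_fun [set: m.+1.-tuple RR] f -> (forall t, 0 <= f t) ->
  \int[M]_t f t =
  \int[gamma1]_x \int[gaussian_tuple m]_t f (insert i x t).
Proof.
move=> ME mf f0; apply: tonelli_insert => //.
  move=> k; rewrite (le_lt_trans (probability_le1 _ _))// ?ltry//.
  exact: measurable_itv.
by move=> A mA; exact: gaussian_tuple_box.
Qed.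

Definition dominated m (C : bool) (a : R) (y : 'I_m -> R) : bool :=
  [forall j, (`|y j| < a ?<= if C)%R].

Definition near_count m (a : R) (y : 'I_m -> R) : nat :=
  (\sum_(j < m) (a <= `|y j|)%R)%N.

Lemma dominated_insert m C a (i : 'I_m.+1) (x : R) (t : m.-tuple RR) :
  dominated C a (tnth (insert i x t)) =
  (`|x| < a ?<= if C)%R && dominated C a (tnth t).
Proof.
apply/forallP/andP => [h|[hx /forallP ht] j].
  split; first by have := h i; rewrite tnth_insert_eq.
  by apply/forallP => j; have := h (lift i j); rewrite tnth_insert_lift.
by case: (unliftP i j) => [k|] ->; rewrite ?tnth_insert_lift ?tnth_insert_eq.
Qed.

Lemma near_count_insert m a (i : 'I_m.+1) (x : R) (t : m.-tuple RR) :
  near_count a (tnth (insert i x t)) =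
  ((a <= `|x|)%R + near_count a (tnth t))%N.
Proof.
rewrite /near_count (bigD1_ord i)//= tnth_insert_eq; congr (_ + _)%N.
by apply: eq_bigr => j _; rewrite tnth_insert_lift.
Qed.

Section measurability.
Context d (T : measurableType d) (m : nat).
Variables (a : T -> R) (g : T -> m.-tuple RR).
Hypotheses (ma : measurable_fun setT a) (mg : measurable_fun setT g).

Lemma measurable_dominated C :
  measurable_fun setT (fun x => dominated C (a x) (tnth (g x))).
Proof.
rewrite (_ : (fun x => _) =
    (fun x => \big[andb/true]_(j < m) (`|tnth (g x) j| < a x ?<= if C)%R)).
  elim: (index_enum _) => [|j r IH].
    by under eq_fun do rewrite big_nil; exact: measurable_cst.
  under eq_fun do rewrite big_cons; apply: measurable_and => //.
  have mn := measurable_norm_tnth mg j.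
  by case: (C); [exact: measurable_fun_ler|exact: measurable_fun_ltr].
by apply/funext => x; rewrite big_andE.
Qed.

Lemma measurable_near_count c :
  measurable_fun setT (fun x => (c <= near_count (a x) (tnth (g x)))%N).
Proof.
rewrite (_ : (fun x => _) =
    (fun x => c%:R <= \sum_(j < m) (a x <= `|tnth (g x) j|)%R%:R :> R)%R).
  apply: measurable_fun_ler => //; apply: measurable_sum => j.
  rewrite (_ : (fun x => _) = (fun x => if (a x <= `|tnth (g x) j|)%R then 1 else 0)%R).
    apply: measurable_fun_ifT => //.
    by apply: measurable_fun_ler => //; exact: measurable_norm_tnth.
  by apply/funext => x; case: (_ <= _)%R.
by apply/funext => x; rewrite -natr_sum ler_nat.
Qed.

End measurability.

(** For [m] independent trials with outcomes of probabilities [p] and [q], the probability that no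
    other outcome occurs and that the first one occurs at least [c] times. The truncation of [c.-1]
    at 0 is intended: nothing more is then required. *)
Fixpoint peak_prob (p q : R) (m c : nat) : R :=
  if m is m'.+1 then p * peak_prob p q m' c.-1 + q * peak_prob p q m' c
  else (c == 0%N)%:R.

Lemma peak_prob_ge0 p q m c : (0 <= p)%R -> (0 <= q)%R ->
  (0 <= peak_prob p q m c)%R.
Proof.
by move=> p0 q0; elim: m c => [|m IH] c //=; rewrite addr_ge0// mulr_ge0.
Qed.

Lemma normal_mass_ge0 u : (0 <= normal_mass u :> R)%R.
Proof.
by rewrite !mulr_ge0 ?gauss_int_ge0// ltW// normal_const_gt0.
Qed.

Lemma normal_peak_strip (C : bool) (a eps : R) : (0 <= eps)%R ->
  \int[gamma1]_x ind ((`|x| < a ?<= if C)%R && (a - eps <= `|x|)%R) =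
    (normal_mass a - normal_mass (a - eps))%:E /\
  \int[gamma1]_x ind ((`|x| < a ?<= if C)%R && (`|x| < a - eps)%R) =
    (normal_mass (a - eps))%:E.
Proof.
move=> e0.
have mn : measurable_fun [set: R] (fun x : R => `|x|%R) by exact: normr_measurable.
have mC (b : R) : measurable_fun [set: R] (fun x : R => (`|x| < b ?<= if C)%R).
  by case: C; [exact: measurable_fun_ler|exact: measurable_fun_ltr].
have E2 : \int[gamma1]_x ind ((`|x| < a ?<= if C)%R && (`|x| < a - eps)%R) =
    (normal_mass (a - eps))%:E.
  rewrite -(@normal_norm_lteif _ false); apply: eq_integral => x _; congr ind.
  apply/andP/idP => [[]//|/= xa]; split => //; apply: lteifS.
  by rewrite (lt_le_trans xa)// gerBl.
split=> //.
have : (normal_mass a)%:E = \int[gamma1]_x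
    (ind ((`|x| < a ?<= if C)%R && (a - eps <= `|x|)%R) +
     ind ((`|x| < a ?<= if C)%R && (`|x| < a - eps)%R)).
  rewrite -(normal_norm_lteif C a); apply: eq_integral => x _.
  rewrite /ind -EFinD -natrD ltNge; congr ((_%:R)%:E).
  by case: (a - eps <= _)%R; rewrite ?andbF ?andbT ?addn0.
rewrite ge0_integralD//; last 4 first.
- by move=> x _; exact: ind_ge0.
- apply: measurable_ind; apply: measurable_and; first exact: mC.
  exact: measurable_fun_ler.
- by move=> x _; exact: ind_ge0.
- apply: measurable_ind; apply: measurable_and; first exact: mC.
  exact: measurable_fun_ltr.
rewrite E2 EFinB => ->; rewrite addeK//.
Qed.

(** The coordinates are independent trials: in the strip of width [eps] below [a] with probability
    [p], below the strip with probability [q], for either value of [C]. *)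
Lemma peak_region_prob m C c (a eps : R) : (0 <= eps)%R ->
  \int[gaussian_tuple m]_t
    ind (dominated C a (tnth t) && (c <= near_count (a - eps) (tnth t))%N) =
  (peak_prob (normal_mass a - normal_mass (a - eps)) (normal_mass (a - eps)) m c)%:E.
Proof.
move=> e0; set p := (normal_mass a - _)%R; set q := normal_mass (a - eps).
have q0 : (0 <= q)%R by exact: normal_mass_ge0.
have [pE qE] := normal_peak_strip C a e0.
have p0 : (0 <= p)%R.
  by rewrite -lee_fin -pE; apply: integral_ge0 => x _; exact: ind_ge0.
have mn : measurable_fun [set: R] (fun x : R => `|x|%R) by exact: normr_measurable.
have mC : measurable_fun [set: R] (fun x : R => (`|x| < a ?<= if C)%R).
  by case: C {pE qE}; [exact: measurable_fun_ler|exact: measurable_fun_ltr].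
have mR n c' : measurable_fun setT (fun t : n.-tuple RR =>
    dominated C a (tnth t) && (c' <= near_count (a - eps) (tnth t))%N).
  have mid : measurable_fun [set: n.-tuple RR] id by exact: measurable_id.
  apply: measurable_and.
    by apply: (measurable_dominated _ mid).
  by apply: (measurable_near_count _ mid).
elim: m c => [|m IH] c.
  rewrite /= integral_dirac//; last by apply: measurable_ind; exact: mR.
  rewrite diracT mul1e /near_count big_ord0 leqn0 /ind.
  by rewrite (_ : dominated _ _ _)//; apply/forallP => -[].
rewrite (tonelli_gaussian ord0 _)//; last 3 first.
- by move=> A mA; exact: (@gaussian_tuple_box m.+1).
- by apply: measurable_ind; exact: mR.
- by move=> t; exact: ind_ge0.
transitivity (\int[gamma1]_x (
    ind ((`|x| < a ?<= if C)%R && (a - eps <= `|x|)%R) * (peak_prob p q m c.-1)%:E +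
    ind ((`|x| < a ?<= if C)%R && (`|x| < a - eps)%R) * (peak_prob p q m c)%:E)).
  apply: eq_integral => x _.
  under eq_integral do rewrite dominated_insert near_count_insert -andbA.
  case: (`|x| < a ?<= if C)%R => /=; last by rewrite !mul0e adde0 integral0.
  have [ax|xa] := leP (a - eps)%R `|x|%R.
    rewrite mul1e mul0e adde0 -IH; apply: eq_integral => t _; congr (ind (_ && _)).
    by case: c {IH} => [|c].
  by rewrite mul1e mul0e add0e -IH.
have m1 : measurable_fun [set: R]
    (fun x : R => ind ((`|x| < a ?<= if C)%R && (a - eps <= `|x|)%R) : \bar R).
  by apply: measurable_ind; apply: measurable_and => //; exact: measurable_fun_ler.
have m2 : measurable_fun [set: R]
    (fun x : R => ind ((`|x| < a ?<= if C)%R && (`|x| < a - eps)%R) : \bar R).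
  by apply: measurable_ind; apply: measurable_and => //; exact: measurable_fun_ltr.
have g0 c' : 0 <= (peak_prob p q m c')%:E by rewrite lee_fin peak_prob_ge0.
rewrite ge0_integralD//; last 4 first.
- by move=> x _; rewrite mule_ge0 ?ind_ge0.
- exact: emeasurable_funM.
- by move=> x _; rewrite mule_ge0 ?ind_ge0.
- exact: emeasurable_funM.
rewrite !ge0_integralZr//; try by move=> x _; exact: ind_ge0.
by rewrite pE qE -!EFinM -EFinD.
Qed.

End gaussian_tuple.

(** * The expectation of the top gap *)

Section order_statistics.
Context {R : realType}.

(** Position [size s - k] holds the [k]-th largest entry, and in a sorted sequence the entries at
    least [a] form a final segment. *)
Lemma le_nth_count (s : seq R) (k : nat) (a : R) :
  sorted <=%R s -> (0 < k <= size s)%N ->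
  (a <= nth 0 s (size s - k)) = (k <= count (fun y => (a <= y)%R) s)%N.
Proof.
move=> ss /andP[k0 ks]; set j := (size s - k)%N.
have js : (j < size s)%N by rewrite ltn_subrL k0 (leq_trans k0).
have mono i i' : (i <= i' < size s)%N -> nth 0 s i <= nth 0 s i'.
  move=> /andP[ii' i's].
  by apply: (sorted_leq_nth le_trans lexx 0 ss) => //; rewrite inE// (leq_ltn_trans ii').
have [aj|ja] := leP a (nth 0 s j); apply/esym.
  rewrite -[s in count _ s](cat_take_drop j) count_cat (leq_trans _ (leq_addl _ _))//.
  have /eqP -> : count (fun y => a <= y) (drop j s) == size (drop j s).
    rewrite -all_count; apply/(all_nthP 0) => i; rewrite size_drop => ij.
    rewrite nth_drop (le_trans aj)// mono// leq_addr/=.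
    by move: ij; rewrite ltn_subRL.
  by rewrite size_drop /j subKn.
rewrite leqNgt; apply/negbF; rewrite -[s in count _ s](cat_take_drop j.+1) count_cat.
rewrite (_ : count _ (take j.+1 s) = 0%N).
  rewrite add0n (leq_ltn_trans (count_size _ _))// size_drop /j subnS subKn//.
  by rewrite prednK.
apply/eqP; rewrite -leqn0 leqNgt -has_count; apply/hasPn => y /(nthP 0)[i].
rewrite size_takel// => ij <-; rewrite -ltNge nth_take// (le_lt_trans _ ja)//.
by rewrite mono// -ltnS ij.
Qed.

Lemma order_stat_max m (x : 'I_m.+1 -> R) : (forall i, 0 <= x i) ->
  order_stat x m.+1 = \big[Num.max/0]_(i < m.+1) x i.
Proof.
move=> x0; rewrite /order_stat /=.
set s := sort _ _; have ss : size s = m.+1 by rewrite size_sort size_map size_enum_ord.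
have srt : sorted <=%R s by apply: sort_sorted; exact: le_total.
apply/eqP; rewrite eq_le; apply/andP; split.
  have : nth 0 s m \in s by rewrite mem_nth// ss.
  by rewrite mem_sort => /mapP[i _ ->]; exact: le_bigmax.
apply/bigmax_leP; split.
  have : nth 0 s m \in s by rewrite mem_nth// ss.
  by rewrite mem_sort => /mapP[i _ ->].
move=> i _; have : x i \in s by rewrite mem_sort; apply: map_f; rewrite mem_enum.
move=> /(nthP 0)[j]; rewrite ss => jm <-.
by apply: (sorted_leq_nth le_trans lexx 0 srt); rewrite ?inE ?ss.
Qed.

Lemma top_gap_le m (x : 'I_m.+1 -> R) (k : nat) (eps : R) :
  (0 < k <= m.+1)%N -> (forall i, 0 <= x i) ->
  (order_stat x m.+1 - order_stat x (m.+1 - k + 1) <= eps) =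
  (k <= \sum_(i < m.+1) ((\big[Num.max/0]_(i < m.+1) x i) - eps <= x i)%R)%N.
Proof.
move=> km x0; rewrite order_stat_max//; set M := \big[Num.max/0]_(i < _) _.
(* The rank [m.+1 - k + 1], counted from 1, is the position [m.+1 - k] counted from 0. *)
rewrite lerBlDr -lerBlDl addn1 /order_stat /=.
set s := sort _ _; have ss : size s = m.+1 by rewrite size_sort size_map size_enum_ord.
have srt : sorted <=%R s by apply: sort_sorted; exact: le_total.
rewrite -[X in nth _ _ (X - _)]ss le_nth_count ?ss//.
rewrite /s count_sort count_map -sum1_count big_mkcond/= big_enum/=.
by congr (_ <= _)%N; apply: eq_bigr => i _ /=; case: (_ <= _).
Qed.

End order_statistics.

Section expectation.
Context {R : realType}.
Notation RR := (measurableTypeR R).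
Notation mu := (@lebesgue_measure R).
Notation gamma1 := (@normal_prob R 0 1).
Local Open Scope ereal_scope.

Lemma normal_mass_homo : {homo @normal_mass R : a b / (a <= b)%R}.
Proof.
move=> a b ab; have e0 : (0 <= b - a)%R by rewrite subr_ge0.
have [E _] := normal_peak_strip true b e0.
rewrite -subr_ge0 -lee_fin -[X in (_ - normal_mass X)%R](subKr b a) -E.
by apply: integral_ge0 => x _; exact: ind_ge0.
Qed.

Lemma measurable_normal_mass d (T : measurableType d) (f : T -> R) :
  measurable_fun setT f -> measurable_fun setT (fun x => normal_mass (f x)).
Proof.
move=> mf; apply: measurableT_comp => //.
by apply: nondecreasing_measurable => //; exact: normal_mass_homo.
Qed.

(* The conditional probability of the top gap event, given that the largest
   absolute value is [a] and is attained at a given index. *)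
Definition gap_prob (m c : nat) (eps a : R) : R :=
  peak_prob (normal_mass a - normal_mass (a - eps)) (normal_mass (a - eps)) m c.

Lemma gap_prob_ge0 m c eps a : (0 <= eps)%R -> (0 <= gap_prob m c eps a)%R.
Proof.
move=> e0; apply: peak_prob_ge0; last exact: normal_mass_ge0.
by rewrite subr_ge0 normal_mass_homo// gerBl.
Qed.

Lemma measurable_gap_prob m c eps : measurable_fun setT (gap_prob m c eps).
Proof.
have mq : measurable_fun [set: R] (fun a : R => normal_mass (a - eps)).
  by apply: measurable_normal_mass; exact: measurable_funB.
have mp : measurable_fun [set: R] (fun a : R => normal_mass a - normal_mass (a - eps))%R.
  by apply: measurable_funB => //; exact: measurable_normal_mass.
rewrite /gap_prob; elim: m c => [|m IH] c //=.
by apply: measurable_funD; apply: measurable_funM.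
Qed.

Definition maxnorm n (y : 'I_n -> R) : R := \big[Num.max/0%R]_(i < n) `|y i|%R.

Lemma measurable_maxnorm n d (T : measurableType d) (g : T -> n.-tuple RR) :
  measurable_fun setT g -> measurable_fun setT (fun x => maxnorm (tnth (g x))).
Proof.
move=> mg; rewrite /maxnorm.
elim: (index_enum _) => [|j r IH].
  by under eq_fun do rewrite big_nil; exact: measurable_cst.
under eq_fun do rewrite big_cons; apply: measurable_maxr => //.
exact: measurable_norm_tnth.
Qed.

Definition gap_payoff n (k : nat) (eps : R) (y : 'I_n -> R) : \bar R :=
  (maxnorm y)%:E * ind (k <= near_count (maxnorm y - eps) y)%N.

(** The share of the payoff with the maximum at index [i]: weakly for [C = true], where ties are
    counted repeatedly, strictly for [C = false], where they are dropped. *)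
Definition peak_payoff n (k : nat) (C : bool) (eps : R) (i : 'I_n)
    (y : 'I_n -> R) : \bar R :=
  (`|y i|)%:E * ind ([forall j, (j != i) ==> (`|y j| < `|y i| ?<= if C)%R] &&
    (k <= near_count (`|y i| - eps) y)%N).

Lemma peak_payoff_ge0 n k C eps (i : 'I_n) y : 0 <= peak_payoff k C eps i y.
Proof. by rewrite mule_ge0 ?ind_ge0// lee_fin. Qed.

Lemma maxnorm_ge n (y : 'I_n -> R) i : (`|y i| <= maxnorm y)%R.
Proof. exact: (le_bigmax _ (fun i => `|y i|%R)). Qed.

Lemma maxnorm_eq n (y : 'I_n -> R) i : (forall j, `|y j| <= `|y i|)%R ->
  maxnorm y = `|y i|%R.
Proof.
move=> h; apply/eqP; rewrite eq_le maxnorm_ge andbT.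
by apply/bigmax_leP; split => // j _; exact: h.
Qed.

Lemma gap_payoff_le m k eps (y : 'I_m.+1 -> R) :
  gap_payoff k eps y <= \sum_(i < m.+1) peak_payoff k true eps i y.
Proof.
have [i yi] : exists i, forall j, (`|y j| <= `|y i|)%R.
  case: (@arg_maxP _ _ _ ord0 xpredT (fun i => `|y i|%R) isT) => i _ yi.
  by exists i => j; exact: yi.
rewrite (bigD1 i)//= /gap_payoff (maxnorm_eq yi).
rewrite -[leLHS]adde0 leeD//; last first.
  by apply: sume_ge0 => j _; exact: peak_payoff_ge0.
rewrite /peak_payoff (_ : [forall j, _] = true)//.
by apply/forallP => j; apply/implyP => _; exact: yi.
Qed.

(** At most one index is a strict maximum; if there is none, the sum is 0. *)
Lemma gap_payoff_ge n k eps (y : 'I_n -> R) :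
  \sum_(i < n) peak_payoff k false eps i y <= gap_payoff k eps y.
Proof.
have [[i yi]|h] := pselect (exists i, forall j, j != i -> (`|y j| < `|y i|)%R).
  have yi' j : (`|y j| <= `|y i|)%R.
    by have [->//|/yi/ltW] := eqVneq j i.
  rewrite (bigD1 i)//= big1 ?adde0 => [|j ji].
    rewrite /gap_payoff (maxnorm_eq yi') /peak_payoff (_ : [forall j, _] = true)//.
    by apply/forallP => j; apply/implyP; exact: yi.
  rewrite /peak_payoff (_ : [forall j, _] = false) ?mule0//.
  apply/negbTE/forallPn; exists i; rewrite eq_sym ji/= -leNgt.
  exact: yi'.
rewrite big1 => [|i _].
  by rewrite mule_ge0 ?ind_ge0// lee_fin; apply/bigmax_geP; left.
rewrite /peak_payoff (_ : [forall j, _] = false) ?mule0//.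
apply/negbTE/negP => /forallP H; apply: h; exists i => j ji.
by have := H j; rewrite ji.
Qed.

Lemma measurable_peak_payoff n k C eps (i : 'I_n) :
  measurable_fun setT (fun t : n.-tuple RR => peak_payoff k C eps i (tnth t)).
Proof.
have mid : measurable_fun [set: n.-tuple RR] id by exact: measurable_id.
have mi := measurable_norm_tnth mid i.
apply: emeasurable_funM; first exact/measurable_EFinP.
apply: measurable_ind; apply: measurable_and; last first.
  by apply: (measurable_near_count _ mid); exact: measurable_funB.
rewrite (_ : (fun x => _) =
    (fun x => \big[andb/true]_(j < n) ((j != i) ==> (`|tnth x j| < `|tnth x i| ?<= if C)%R))).
  elim: (index_enum _) => [|j r IH].
    by under eq_fun do rewrite big_nil; exact: measurable_cst.
  under eq_fun do rewrite big_cons; apply: measurable_and => //.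
  case: (j != i) => //=.
  have mj := measurable_norm_tnth mid j.
  by case: (C); [exact: measurable_fun_ler|exact: measurable_fun_ltr].
by apply/funext => x; rewrite big_andE.
Qed.

Lemma measurable_gap_payoff n k eps :
  measurable_fun setT (fun t : n.-tuple RR => gap_payoff k eps (tnth t)).
Proof.
have mid : measurable_fun [set: n.-tuple RR] id by exact: measurable_id.
have mM := measurable_maxnorm mid.
apply: emeasurable_funM; first exact/measurable_EFinP.
apply: measurable_ind; apply: (measurable_near_count _ mid).
exact: measurable_funB.
Qed.

(** [|x|] rather than [x] keeps the payoff nonnegative on the whole line, as
    [integral_normal_prob_norm] asks. *)
Definition gap_integral (m c : nat) (eps : R) : \bar R :=
  (2 * normal_const)%:E * \int[mu]_x (ind (0 <= x)%R *
    (`|x| * gap_prob m c eps x * expR (- x ^+ 2 / 2))%:E).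

(** Given coordinate [i], the others are independent and must be dominated by it. It is itself near
    the maximum, so [k] near coordinates remain to be found among the others. *)
Lemma peak_payoff_integral m k C eps (i : 'I_m.+1)
    (M : {measure set (m.+1.-tuple RR) -> \bar R}) : (0 <= eps)%R ->
  (forall A, (forall i, measurable (A i)) ->
    M (box A) = (\prod_j gamma1 (A j))%E) ->
  \int[M]_t peak_payoff k.+1 C eps i (tnth t) = gap_integral m k eps.
Proof.
move=> e0 ME; rewrite (tonelli_gaussian i ME); last 2 first.
- exact: measurable_peak_payoff.
- by move=> t; exact: peak_payoff_ge0.
rewrite /gap_integral -(@integral_normal_prob_norm _ (fun x => `|x| * gap_prob m k eps x)%R); last 2 first.
- by apply: measurable_funM; [exact: normr_measurable|exact: measurable_gap_prob].
- by move=> x; rewrite mulr_ge0// gap_prob_ge0.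
apply: eq_integral => x _; rewrite normr_id EFinM /gap_prob.
rewrite -(@peak_region_prob _ m C)// -ge0_integralZl//; last 2 first.
- have mid : measurable_fun [set: m.-tuple RR] id by exact: measurable_id.
  apply: measurable_ind; apply: measurable_and.
    by apply: (measurable_dominated _ mid).
  by apply: (measurable_near_count _ mid).
- by move=> t _; exact: ind_ge0.
apply: eq_integral => t _; rewrite /peak_payoff tnth_insert_eq near_count_insert.
rewrite gerBl e0 add1n ltnS; congr (_ * ind (_ && _)).
apply/forallP/forallP => h j.
  by have := h (lift i j); rewrite tnth_insert_lift eq_sym neq_lift.
by case: (unliftP i j) => [j'|] ->; rewrite ?eqxx// tnth_insert_lift h implybT.
Qed.

(** The strict and the weak sums have the same integral, hence so does the payoff squeezed between
    them. *)
Lemma gap_payoff_integral m k eps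
    (M : {measure set (m.+1.-tuple RR) -> \bar R}) : (0 <= eps)%R ->
  (forall A, (forall i, measurable (A i)) ->
    M (box A) = (\prod_j gamma1 (A j))%E) ->
  \int[M]_t gap_payoff k.+1 eps (tnth t) = m.+1%:R%:E * gap_integral m k eps.
Proof.
move=> e0 ME.
have g0 : 0 <= gap_integral m k eps.
  rewrite -(peak_payoff_integral k true ord0 e0 ME).
  by apply: integral_ge0 => t _; exact: peak_payoff_ge0.
have S C : \int[M]_t \sum_(i < m.+1) peak_payoff k.+1 C eps i (tnth t) =
    m.+1%:R%:E * gap_integral m k eps.
  rewrite ge0_integral_sum//; last 2 first.
  - by move=> i; exact: measurable_peak_payoff.
  - by move=> i t _; exact: peak_payoff_ge0.
  by under eq_bigr do rewrite (peak_payoff_integral _ _ _ e0 ME); rewrite ge0_sum_cst.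
have gp0 n (y : 'I_n -> R) : 0 <= gap_payoff k.+1 eps y.
  by apply: le_trans (gap_payoff_ge _ _ _); apply: sume_ge0 => i _; exact: peak_payoff_ge0.
apply/eqP; rewrite eq_le -{1}(S true) -(S false); apply/andP; split.
  apply: ge0_le_integral => //.
  - exact: measurable_gap_payoff.
  - by apply: emeasurable_sum => i; exact: measurable_peak_payoff.
  - by move=> t _; exact: gap_payoff_le.
apply: ge0_le_integral => //.
- by move=> t _; apply: sume_ge0 => i _; exact: peak_payoff_ge0.
- by apply: emeasurable_sum => i; exact: measurable_peak_payoff.
- exact: measurable_gap_payoff.
- by move=> t _; exact: gap_payoff_ge.
Qed.

End expectation.

(** * The limit *)

Section gauss_calculus.
Context {R : realType}.
Notation RR := (measurableTypeR R).
Notation mu := (@lebesgue_measure R).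
Let g (x : R) : R := expR (- x ^+ 2 / 2).

Lemma gauss_le1 x : g x <= 1.
Proof. by rewrite -[leRHS]expR0 ler_expR; have := sqr_ge0 x; lra. Qed.

Let mg : measurable_fun setT g.
Proof. by apply: continuous_measurable_fun; exact: continuous_gauss. Qed.

Let measurable_itv_ind (a b : R) :
  measurable_fun [set: R] (fun x : R => ind (a <= x <= b) : \bar R).
Proof. by apply: measurable_ind; apply: measurable_and; exact: measurable_fun_ler. Qed.

Let mgi (a b : R) :
  measurable_fun [set: R] (fun x : R => (ind (a <= x <= b)%R * (g x)%:E)%E).
Proof. by apply: emeasurable_funM => //; exact/measurable_EFinP. Qed.

(** The integrand lies between 0 and 1. This gives continuity, also across 0, and bounds the mass of
    a strip of width [eps]. *)
Lemma gauss_int_lipschitz (a b : R) : a <= b ->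
  0 <= gauss_int b - gauss_int a <= b - a.
Proof.
move=> ab; rewrite subr_ge0; apply/andP; split.
  rewrite -lee_fin !gauss_intE; apply: ge0_le_integral => //.
  - by move=> x _; rewrite mule_ge0 ?ind_ge0// lee_fin expR_ge0.
  - exact: mgi.
  - exact: mgi.
  move=> x _; rewrite lee_wpmul2r ?lee_fin ?expR_ge0//.
  by case: (0 <= x) => //=; have [xa|] := leP x a; rewrite ?(le_trans xa ab).
rewrite lerBlDl -lee_fin EFinD -(integral_ind_itv ab) !gauss_intE.
rewrite -ge0_integralD//; last 4 first.
- by move=> x _; rewrite mule_ge0 ?ind_ge0// lee_fin expR_ge0.
- exact: mgi.
- by move=> x _; exact: ind_ge0.
- exact: measurable_itv_ind.
apply: ge0_le_integral => //.
- by move=> x _; rewrite mule_ge0 ?ind_ge0// lee_fin expR_ge0.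
- exact: mgi.
- by apply: emeasurable_funD; [exact: mgi|exact: measurable_itv_ind].
move=> x _; rewrite /ind -!EFinM -EFinD lee_fin.
have gx1 := gauss_le1 x; have gx0 : 0 <= g x by exact: expR_ge0.
case: (0 <= x); rewrite ?mul0r ?add0r//=.
have [xa|ax] := leP x a.
  by rewrite (le_trans xa ab) !mul1r lerDl.
by rewrite (ltW ax) mul0r add0r/=; case: (x <= b); rewrite ?mul1r ?mul0r.
Qed.

Lemma gauss_int0 (x : R) : x <= 0 -> gauss_int x = 0.
Proof.
move=> x0; apply: EFin_inj; rewrite gauss_intE.
rewrite -(@integral_ind_mul _ _ RR mu) (@integral_Sset1 _ _ _ 0)//.
by move=> y /= /andP[y0 yx]; apply/eqP; rewrite eq_le y0 (le_trans yx x0).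
Qed.

Lemma continuous_gauss_int : continuous (@gauss_int R).
Proof.
move=> x; apply/cvgrPdist_le => e e0.
have H : \forall y \near x, `|x - y| <= e.
  by have /cvgrPdist_le/(_ e e0) := @cvg_id _ (nbhs x).
apply: filterS H => y; apply: le_trans.
have [xy|/ltW yx] := leP x y.
  have /andP[h0 h1] := gauss_int_lipschitz xy.
  by rewrite distrC ger0_norm// (le_trans h1)// distrC ler_norm.
have /andP[h0 h1] := gauss_int_lipschitz yx.
by rewrite ger0_norm// (le_trans h1)// ler_norm.
Qed.

(** At 0 the function has a corner: it is constant to the left and has slope 1 to the right. *)
Lemma is_derive_gauss_int (x : R) : 0 < x -> is_derive x 1 (@gauss_int R) (g x).
Proof.
move=> x0; have xx1 : x < x + 1 by rewrite ltrDl.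
have [d e] := continuous_FTC1_closed xx1 (integrable_gauss_itv (x + 1)) x0 (@continuous_gauss R x).
by apply: DeriveDef => //; rewrite -derive1E e.
Qed.

Lemma gauss_int_expr (N : nat) (x : R) : 0 <= x ->
  ((gauss_int x ^+ N.+1)%:E = \int[mu]_s (ind (0 <= s <= x)%R *
    (N.+1%:R * gauss_int s ^+ N * g s)%:E))%E.
Proof.
rewrite le_eqVlt => /predU1P[<-|x0].
  rewrite gauss_int0// expr0n/= -(@integral_ind_mul _ _ RR mu) (@integral_Sset1 _ _ _ 0)//.
  by move=> y /= /andP[y0 yx]; apply/eqP; rewrite eq_le y0 yx.
rewrite -(@integral_ind_mul _ _ RR mu).
rewrite (_ : [set s : R | 0 <= s <= x] = [set` `[0, x]]); last first.
  by apply/seteqP; split => y; rewrite /= in_itv.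
rewrite (@continuous_FTC2 _ _ (@gauss_int R ^+ N.+1)).
- by rewrite !exprfctE (gauss_int0 (lexx 0)) expr0n/= -EFinB subr0.
- exact: x0.
- apply: continuous_subspaceT => s; apply: cvgM; last exact: continuous_gauss.
  apply: cvgM; first exact: cvg_cst.
  apply: (@continuous_comp _ _ _ (@gauss_int R) (fun y => y ^+ _)).
    exact: continuous_gauss_int.
  exact: exprn_continuous.
- have cF : continuous (@gauss_int R ^+ N.+1).
    move=> s; rewrite exprfctE.
    apply: (@continuous_comp _ _ _ (@gauss_int R) (fun y => y ^+ _)).
    exact: continuous_gauss_int.
  exact: exprn_continuous.
  split.
  + move=> s; rewrite in_itv/= => /andP[s0 _].
    by have ds := is_derive_gauss_int s0; exact: ex_derive.
  + by apply: cvg_at_right_filter; exact: cF.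
  + by apply: cvg_at_left_filter; exact: cF.
- move=> s; rewrite in_itv/= => /andP[s0 _]; have ds := is_derive_gauss_int s0.
  by rewrite derive1E derive_val.
Qed.

Lemma gauss_tail (K s : R) : 0 < K -> 0 <= s ->
  (\int[mu]_x (ind (s <= x)%R * (x * expR (- (K * x ^+ 2) / 2))%:E) =
   (expR (- (K * s ^+ 2) / 2) / K)%:E)%E.
Proof.
move=> K0 s0; rewrite -(@integral_ind_mul _ _ RR mu).
rewrite (_ : [set x : R | s <= x] = [set` `[s, +oo[]); last first.
  by apply/seteqP; split => y; rewrite /= in_itv/= andbT.
pose p : {poly R} := (- (K / 2)) *: 'X^2.
have pE x : p.[x] = - (K * x ^+ 2) / 2 by rewrite /p hornerZ hornerXn; ring.
pose F x := - (K^-1 * expR p.[x]).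
have dF (x : R) : is_derive x 1 F (x * expR (- (K * x ^+ 2) / 2)).
  have := is_deriveN (is_deriveZ K^-1 (is_derive1_comp (is_derive_expR p.[x]) (is_derive_poly p x))).
  have -> : p^`().[x] = - K * x.
    by rewrite /p derivZ derivXn hornerZ hornerMn hornerXn expr1 -mulr_natr; lra.
  move=> H; apply: is_derive_eq H _; rewrite -pE.
  rewrite -[LHS]/(- (K^-1 * (expR p.[x] * (- K * x)))).
  by field; rewrite gt_eqF.
have cp : continuous (horner p) by exact: continuous_horner.
have cF : continuous F.
  by move=> x; apply/differentiable_continuous/derivable1_diffP; exact: ex_derive.
rewrite (@ge0_continuous_FTC2y _ _ F s 0).
- by rewrite -EFinB sub0r /F opprK pE mulrC.
- by move=> x sx; rewrite mulr_ge0 ?expR_ge0// (le_trans s0).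
- apply: continuous_subspaceT => x; apply: cvgM; first exact: cvg_id.
  under [X in X @ _ --> _]eq_fun do rewrite -pE.
  by rewrite -pE; apply: continuous_comp; [exact: cp|exact: continuous_expR].
- rewrite -oppr0; apply: cvgN; rewrite -(mulr0 K^-1); apply: cvgMl_tmp.
  have h : (K / 2 * x ^+ 2) @[x --> +oo] --> +oo.
    by apply: gt0_cvgMry; [rewrite divr_gt0|exact: cvgr_expr2].
  have := cvg_comp _ _ h (@cvgr_expR R); apply: cvg_trans.
  by apply: near_eq_cvg; apply: nearW => x; rewrite /= pE; congr expR; ring.
- by move=> x _; exact: ex_derive.
- by apply: cvg_at_right_filter; exact: cF.
- by move=> x _; rewrite derive1E derive_val.
Qed.

Lemma integral_ind_ge0_gt0 (f : R -> \bar R) : measurable_fun setT f ->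
  (\int[mu]_x (ind (0 <= x)%R * f x) = \int[mu]_x (ind (0 < x)%R * f x))%E.
Proof.
move=> mf; rewrite -!(@integral_ind_mul _ _ RR mu).
rewrite (_ : [set x : R | 0 <= x] = [set` `[0, +oo[]); last first.
  by apply/seteqP; split => y; rewrite /= in_itv/= andbT.
rewrite (_ : [set x : R | 0 < x] = [set` `]0, +oo[]); last first.
  by apply/seteqP; split => y; rewrite /= in_itv/= andbT.
by rewrite integral_itv_obnd_cbnd//; exact: measurable_funTS.
Qed.

(** [gauss_int x ^ N.+1] is the integral of its derivative over [[0, x]]; after exchanging the
    integrals, the remaining factor integrated over [x >= s] is a [gauss_tail]. No boundary term at
    infinity arises. *)
Lemma gauss_by_parts (c N : nat) :
  (\int[mu]_x (ind (0 <= x)%R *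
     (x * expR (- (c.+1%:R * x ^+ 2) / 2) * gauss_int x ^+ N.+1)%:E) =
   (N.+1%:R / c.+1%:R)%:E * \int[mu]_s (ind (0 < s)%R *
     (expR (- (c.+2%:R * s ^+ 2) / 2) * gauss_int s ^+ N)%:E))%E.
Proof.
have mgc (k : nat) : measurable_fun [set: R] (fun x : R => expR (- (k%:R * x ^+ 2) / 2)).
  apply: measurableT_comp => //; apply: measurable_funM => //.
  by apply: measurableT_comp => //; apply: measurable_funM => //; exact: exprn_measurable.
have mG : measurable_fun [set: R] (@gauss_int R).
  by apply: continuous_measurable_fun; exact: continuous_gauss_int.
have h0 s : 0 <= gauss_int s :> R by exact: gauss_int_ge0.
pose e (x : R) : R := x * expR (- (c.+1%:R * x ^+ 2) / 2).
have me : measurable_fun setT e by exact: measurable_funM.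
pose f (s : R) : R := N.+1%:R * gauss_int s ^+ N * g s.
have mf : measurable_fun setT f.
  by apply: measurable_funM => //; apply: measurable_funM => //; exact: measurable_funX.
have f0 s : 0 <= f s by rewrite !mulr_ge0 ?exprn_ge0 ?expR_ge0.
pose H (p : RR * RR) : \bar R :=
  (ind ((0 <= p.1) && (0 <= p.2 <= p.1))%R * ((e p.1)%:E * (f p.2)%:E))%E.
have m1 : measurable_fun setT (fun p : RR * RR => p.1 : R) by exact: measurable_fst.
have m2 : measurable_fun setT (fun p : RR * RR => p.2 : R) by exact: measurable_snd.
have mH : measurable_fun setT H.
  apply: emeasurable_funM.
    apply: measurable_ind; apply: measurable_and; first exact: measurable_fun_ler.
    by apply: measurable_and; exact: measurable_fun_ler.
  by apply: emeasurable_funM; apply/measurable_EFinP; exact: measurableT_comp.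
have H0 p : (0 <= H p)%E.
  rewrite /H; have [p0|_] := leP 0 p.1; last by rewrite mul0e.
  by rewrite !mule_ge0 ?ind_ge0 ?lee_fin// mulr_ge0// expR_ge0.
have := fubini_tonelli (m1 := mu) (m2 := mu) H mH H0.
rewrite [X in X = _ -> _](_ : _ = \int[mu]_x (ind (0 <= x)%R *
     (x * expR (- (c.+1%:R * x ^+ 2) / 2) * gauss_int x ^+ N.+1)%:E))%E; last first.
  apply: eq_integral => x _; rewrite /H/=.
  have [x0|_] := leP 0 x; last by rewrite mul0e; apply: integral0_eq => s _; rewrite mul0e.
  rewrite mul1e [in RHS]EFinM gauss_int_expr// -ge0_integralZl//.
  - by apply: eq_integral => s _; rewrite muleCA.
  - by apply: emeasurable_funM; [exact: measurable_itv_ind|exact/measurable_EFinP].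
  - by move=> s _; rewrite mule_ge0 ?ind_ge0// lee_fin; exact: f0.
  - by rewrite lee_fin mulr_ge0// expR_ge0.
have mk : measurable_fun [set: R] (fun s : R =>
    (expR (- (c.+2%:R * s ^+ 2) / 2) * gauss_int s ^+ N)%:E).
  apply/measurable_EFinP; apply: measurable_funM; first exact: mgc.
  exact: measurable_funX.
move=> ->; rewrite -integral_ind_ge0_gt0// -ge0_integralZl//; last 2 first.
- by apply: emeasurable_funM => //; apply: measurable_ind; exact: measurable_fun_ler.
- by move=> s _; rewrite mule_ge0 ?ind_ge0// lee_fin mulr_ge0 ?expR_ge0 ?exprn_ge0.
apply: eq_integral => s _; rewrite /H/=.
have [s0|s0] := leP 0 s; last first.
  by rewrite mul0e mule0; apply: integral0_eq => x _; rewrite andbF mul0e.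
rewrite mul1e.
transitivity (\int[mu]_x ((f s)%:E * (ind (s <= x)%R * (e x)%:E)))%E.
  apply: eq_integral => x _; have [sx|xs] := leP s x; last by rewrite /= ?andbF !mul0e mule0.
  by rewrite (le_trans s0 sx)/= !mul1e muleC.
rewrite ge0_integralZl//; last 3 first.
- apply: emeasurable_funM; first by apply: measurable_ind; exact: measurable_fun_ler.
  exact/measurable_EFinP.
- move=> x _; have [sx|xs] := leP s x; last by rewrite mul0e.
  by rewrite mul1e lee_fin mulr_ge0 ?expR_ge0// (le_trans s0 sx).
- by rewrite lee_fin.
rewrite gauss_tail// -!EFinM; congr EFin; rewrite /f /g.
have -> : expR (- (c.+2%:R * s ^+ 2) / 2) = expR (- s ^+ 2 / 2) * expR (- (c.+1%:R * s ^+ 2) / 2).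
  by rewrite -expRD -[c.+2%:R]natr1; congr expR; lra.
by ring.
Qed.

End gauss_calculus.

Section gap_limit.
Context {R : realType}.
Notation RR := (measurableTypeR R).
Notation mu := (@lebesgue_measure R).
Notation gamma1 := (@normal_prob R 0 1).
Let g (x : R) : R := expR (- x ^+ 2 / 2).

Lemma normal_mass_le1 (u : R) : normal_mass u <= 1.
Proof.
rewrite -lee_fin -(normal_norm_lteif true) (@integral_ind _ _ RR gamma1); last first.
  have : measurable_fun [set: R] (fun x : R => `|x| <= u).
    by apply: measurable_fun_ler => //; exact: normr_measurable.
  by [].
apply: probability_le1; rewrite -[X in measurable X]setTI.
have : measurable_fun [set: R] (fun x : R => `|x| <= u).
  by apply: measurable_fun_ler => //; exact: normr_measurable.
by apply.
Qed.

(** Uniform in [x], to dominate after division by [eps ^ c]. A coordinate contributes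
    [2 * normal_const * eps] when it is used as one of the [c] near ones, and at most 1
    otherwise. *)
Lemma gap_prob_le m c (eps x : R) : 0 < eps ->
  gap_prob m c eps x <= (2 * normal_const + 1) ^+ m * eps ^+ c.
Proof.
move=> e0; rewrite /gap_prob; set p := _ - _; set q := normal_mass (x - eps).
have q0 : 0 <= q by exact: normal_mass_ge0.
have q1 : q <= 1 by exact: normal_mass_le1.
have p0 : 0 <= p by rewrite subr_ge0 normal_mass_homo// gerBl ltW.
have pq : p + q <= 1 by rewrite subrK; exact: normal_mass_le1.
set K := 2 * normal_const.
have K0 : 0 <= K by rewrite mulr_ge0// ltW// normal_const_gt0.
have pK : p <= K * eps.
  rewrite /p /normal_mass -/K -mulrBr ler_wpM2l//.
  have /gauss_int_lipschitz/andP[_ h] : x - eps <= x by rewrite gerBl ltW.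
  by rewrite (le_trans h)// opprB addrC subrK.
elim: m c => [|m IH] [|c] /=; rewrite ?expr0 ?mul1r//.
- by rewrite exprn_ge0// ltW.
- rewrite mulr1 -mulrDl exprS; have := IH 0%N; rewrite expr0 mulr1 => IH0.
  have P0 := peak_prob_ge0 m 0 p0 q0.
  apply: (@le_trans _ _ (1 * peak_prob p q m 0)); first by rewrite ler_wpM2r.
  by apply: ler_pM => //; rewrite lerDr.
- rewrite [leRHS](_ : _ = (K * eps) * ((K + 1) ^+ m * eps ^+ c) +
      (K + 1) ^+ m * eps ^+ c.+1); last by rewrite !exprS; ring.
  rewrite lerD//.
    by apply: ler_pM => //; exact: peak_prob_ge0.
  apply: (@le_trans _ _ (1 * peak_prob p q m c.+1)).
    by rewrite ler_wpM2r// peak_prob_ge0.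
  by rewrite mul1r; exact: IH.
Qed.

Section along_sequence.
Variable u : R^nat.
Hypotheses (u0 : forall n, 0 < u n) (u_cvg : u n @[n --> \oo] --> 0).

Lemma gauss_quotient_cvg (x : R) : 0 < x ->
  (gauss_int x - gauss_int (x - u n)) / u n @[n --> \oo] --> g x.
Proof.
move=> x0; have [d e] := is_derive_gauss_int x0.
have H : (fun h : R => h^-1 *: ((@gauss_int R \o shift x) (h *: 1) - gauss_int x)) @ 0^' --> g x.
  by rewrite /g -e; exact: d.
have v0 : (forall n, - u n != 0) /\ (- u n @[n --> \oo] --> 0).
  split; first by move=> n; rewrite oppr_eq0 gt_eqF.
  by rewrite -oppr0; exact: cvgN.
have := (cvgr_dnbhsP _ _ _).1 H _ v0; apply: cvg_trans; apply: near_eq_cvg.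
apply: nearW => n /=; rewrite -[(- u n) *: 1]/(- u n * 1) mulr1 (addrC _ x).
by rewrite -[LHS]/((- u n)^-1 * _) invrN mulNr -mulrN opprB mulrC.
Qed.

Lemma gauss_shift_cvg (x : R) : gauss_int (x - u n) @[n --> \oo] --> gauss_int x.
Proof.
have H : x - u n @[n --> \oo] --> x.
  by rewrite -[X in _ --> X]subr0; apply: cvgB => //; exact: cvg_cst.
exact: (cvg_comp _ _ H (@continuous_gauss_int R x)).
Qed.

(** To leading order exactly [c] of the [m] coordinates are near, each with probability about
    [2 * normal_const * g x * u n]; further near ones cost higher powers of [u n]. The recursion
    reproduces Pascal's rule. *)
Lemma gap_prob_cvg m c (x : R) : 0 < x ->
  gap_prob m c (u n) x / u n ^+ c @[n --> \oo] -->
  'C(m, c)%:R * (2 * normal_const * g x) ^+ c * normal_mass x ^+ (m - c).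
Proof.
move=> x0; rewrite /gap_prob.
pose p n := normal_mass x - normal_mass (x - u n).
pose q n := normal_mass (x - u n).
have qc : q n @[n --> \oo] --> normal_mass x.
  by apply: cvgMl_tmp; exact: gauss_shift_cvg.
have pc : p n / u n @[n --> \oo] --> 2 * normal_const * g x.
  rewrite (_ : (fun n => _) = (fun n => 2 * normal_const *
     ((gauss_int x - gauss_int (x - u n)) / u n))).
    by apply: cvgMl_tmp; exact: gauss_quotient_cvg.
  by apply/funext => n; rewrite /p /normal_mass; ring.
have p0 : p n @[n --> \oo] --> 0.
  rewrite -(subrr (normal_mass x)); apply: cvgB => //; exact: cvg_cst.
rewrite -/(p _) -/(q _).
elim: m c => [|m IH] c.
  case: c => [|c] /=.
    rewrite bin0 !expr0 !mulr1 ?subn0 ?expr0 ?mulr1.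
    by under eq_fun do rewrite expr0 divr1; exact: cvg_cst.
  by rewrite bin0n mul0r mul0r; under eq_fun do rewrite mul0r; exact: cvg_cst.
case: c => [|c] /=.
  have IH0 : peak_prob (p n) (q n) m 0 @[n --> \oo] --> normal_mass x ^+ m.
    have := IH 0%N; rewrite bin0 expr0 !mul1r subn0.
    by under eq_fun do rewrite expr0 divr1.
  rewrite bin0 expr0 !mul1r subn0 exprS.
  under eq_fun do rewrite expr0 divr1 -mulrDl.
  apply: cvgM => //.
  by rewrite -[X in _ --> X]add0r; exact: cvgD.
rewrite (_ : (fun n => _) = (fun n =>
    (p n / u n) * (peak_prob (p n) (q n) m c / u n ^+ c) +
    q n * (peak_prob (p n) (q n) m c.+1 / u n ^+ c.+1))); last first.
  apply/funext => n; rewrite -/(p n) -/(q n) exprS; field.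
  by rewrite expf_neq0 gt_eqF.
rewrite (_ : 'C(m.+1, c.+1)%:R * _ * _ =
   (2 * normal_const * g x) * ('C(m, c)%:R * (2 * normal_const * g x) ^+ c * normal_mass x ^+ (m - c)) +
   normal_mass x * ('C(m, c.+1)%:R * (2 * normal_const * g x) ^+ c.+1 * normal_mass x ^+ (m - c.+1))).
  by apply: cvgD; apply: cvgM => //; exact: IH.
(* If [m <= c] then ['C(m, c.+1)] is 0, which removes the term with the truncated exponent. *)
rewrite subSS binS natrD; have [cm|mc] := ltnP c m.
  by rewrite -(subnSK cm) !exprS; ring.
by rewrite (bin_small (_ : m < c.+1)%N)// !exprS; ring.
Qed.

End along_sequence.
End gap_limit.

Section gap_integral_limit.
Context {R : realType}.
Notation RR := (measurableTypeR R).
Notation mu := (@lebesgue_measure R).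
Let g (x : R) : R := expR (- x ^+ 2 / 2).
Variables (m c : nat).
Local Open Scope ereal_scope.

Let lim_density (x : R) : R :=
  ('C(m, c)%:R * (2 * normal_const * g x) ^+ c * normal_mass x ^+ (m - c))%R.

Let mg : measurable_fun [set: R] g.
Proof. by apply: continuous_measurable_fun; exact: continuous_gauss. Qed.

Let measurable_lim_density : measurable_fun [set: R] lim_density.
Proof.
apply: measurable_funM; last by apply: measurable_funX; exact: measurable_normal_mass.
apply: measurable_funM => //; apply: measurable_funX; exact: measurable_funM.
Qed.

Let lim_density_ge0 x : (0 <= lim_density x)%R.
Proof.
have nc0 := ltW (@normal_const_gt0 R).
apply: mulr_ge0; last by rewrite exprn_ge0// normal_mass_ge0.
by rewrite mulr_ge0// exprn_ge0// !mulr_ge0// expR_ge0.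
Qed.

Let payoff (f : R -> R) (x : R) : \bar R :=
  ind (0 <= x)%R * (`|x| * f x * g x)%:E.

Let measurable_payoff f : measurable_fun [set: R] f ->
  measurable_fun [set: R] (payoff f).
Proof.
move=> mf; apply: emeasurable_funM.
  by apply: measurable_ind; exact: measurable_fun_ler.
by apply/measurable_EFinP; apply: measurable_funM => //; apply: measurable_funM.
Qed.

Let B : R := ((2 * normal_const + 1) ^+ m)%R.

Let integrable_bound : mu.-integrable setT (payoff (cst B)).
Proof.
have B0 : (0 <= B)%R.
  by rewrite exprn_ge0// addr_ge0// mulr_ge0// ltW// normal_const_gt0.
apply/integrableP; split; first exact: measurable_payoff.
rewrite [ltLHS](_ : _ = \int[mu]_x (B%:E * (ind (0 <= x)%R *
    (x * expR (- (1 * x ^+ 2) / 2))%:E))); last first.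
  apply: eq_integral => x _; rewrite gee0_abs; last first.
    by rewrite mule_ge0 ?ind_ge0// lee_fin !mulr_ge0 ?expR_ge0.
  rewrite muleCA /payoff; have [x0|_] := leP 0%R x; last by rewrite !mul0e.
  by rewrite ger0_norm// !mul1e -EFinM mul1r /g; congr EFin; rewrite /=; ring.
rewrite ge0_integralZl//.
- by rewrite gauss_tail// -EFinM ltry.
- apply: emeasurable_funM; first by apply: measurable_ind; exact: measurable_fun_ler.
  apply/measurable_EFinP; apply: measurable_funM => //.
  by under eq_fun do rewrite mul1r.
- move=> x _; have [x0|_] := leP 0%R x; last by rewrite mul0e.
  by rewrite mul1e lee_fin mulr_ge0// expR_ge0.
Qed.

Let dominated_payoff (u : R^nat) : (forall n, 0 < u n)%R ->
  (u n @[n --> \oo] --> 0%R) ->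
  [/\ mu.-integrable setT (payoff lim_density) &
   \int[mu]_x payoff (fun y => gap_prob m c (u n) y / u n ^+ c)%R x @[n --> \oo] -->
   \int[mu]_x payoff lim_density x].
Proof.
move=> u0 uc.
have := @dominated_convergence _ _ R mu setT measurableT
  (fun n => payoff (fun y => gap_prob m c (u n) y / u n ^+ c)%R)
  (payoff lim_density) (payoff (cst B)).
case.
- move=> n; apply: measurable_payoff; apply: measurable_funM => //.
  exact: measurable_gap_prob.
- exact: measurable_payoff.
- apply: aeW => x _; rewrite /payoff.
  (* [gap_prob_cvg] asks for [x > 0]; for [x < 0] the indicator vanishes, and at 0 the factor [|x|]
     does. *)
  have [x0|x0] := ltP 0%R x; last first.
    have [xlt|xge] := ltP x 0%R.
      by under eq_fun do rewrite mul0e; rewrite mul0e; exact: cvg_cst.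
    have -> : x = 0%R by apply/eqP; rewrite eq_le x0.
    by under eq_fun do rewrite normr0 !mul0r mule0; rewrite normr0 !mul0r mule0; exact: cvg_cst.
  rewrite (ltW x0).
  under eq_fun do rewrite mul1e; rewrite mul1e; apply: cvg_EFin; first exact: nearW.
  apply: cvgMr_tmp; apply: cvgMl_tmp; exact: gap_prob_cvg.
- exact: integrable_bound.
- apply: aeW => x n _; rewrite /payoff.
  have h : (0 <= gap_prob m c (u n) x / u n ^+ c <= B)%R.
    have un : (0 < u n ^+ c)%R by rewrite exprn_gt0.
    rewrite divr_ge0 ?(ltW un) ?gap_prob_ge0 ?(ltW (u0 n))//=.
    by rewrite ler_pdivrMr// gap_prob_le.
  move: h => /andP[h0 h1].
  rewrite gee0_abs; last by rewrite mule_ge0 ?ind_ge0// lee_fin mulr_ge0 ?expR_ge0// mulr_ge0.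
  by rewrite lee_wpmul2l ?ind_ge0// lee_fin ler_wpM2r ?expR_ge0// ler_wpM2l.
by move=> H1 _ H2; split.
Qed.

Definition gap_limit : R :=
  (2 * normal_const * fine (\int[mu]_x payoff lim_density x))%R.

Lemma gap_integral_cvg :
  (eps ^- c)%:E * gap_integral m c eps @[eps --> 0%R^'+] --> gap_limit%:E.
Proof.
(* Dominated convergence concerns sequences, so the one-sided limit is tested on positive null
   sequences. *)
apply/cvge_at_rightP => u [u0 uc].
have [fi H] := dominated_payoff u0 uc.
rewrite /gap_limit EFinM fineK; last exact: integrable_fin_num fi.
rewrite (_ : (fun n => _) = (fun n => (2 * normal_const)%:E *
    \int[mu]_x payoff (fun y => gap_prob m c (u n) y / u n ^+ c)%R x)).
  by apply: cvgeZl => //.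
apply/funext => n; rewrite /gap_integral muleCA; congr (_ * _).
have c0 : (0 <= u n ^- c)%R by rewrite invr_ge0 exprn_ge0// ltW.
rewrite -ge0_integralZl//.
- apply: eq_integral => x _; rewrite muleCA /payoff; congr (_ * _).
  by rewrite -EFinM /g; congr EFin; ring.
- exact: (measurable_payoff (measurable_gap_prob m c (u n))).
- by move=> x _; rewrite mule_ge0 ?ind_ge0// lee_fin mulr_ge0 ?expR_ge0// mulr_ge0// gap_prob_ge0// ltW.
Qed.

(** As [m - c >= 1], [gauss_by_parts] applies; its factor [(m - c) / c.+1] turns ['C(m, c)] into
    ['C(m, c.+1)]. *)
Lemma gap_limitE : (c < m)%N ->
  gap_limit%:E = ('C(m, c.+1)%:R * (2 * normal_const) ^+ m.+1)%:E *
    face_integral m c.+1.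
Proof.
move=> cm.
(* Any positive null sequence serves: only the integrability of the limit payoff is drawn from
   it. *)
pose u n : R := (n.+1%:R^-1)%R.
have u0 n : (0 < u n)%R by rewrite invr_gt0.
have uc : u n @[n --> \oo] --> (0 : R)%R by exact: cvg_harmonic.
have [fi _] := dominated_payoff u0 uc.
rewrite /gap_limit EFinM fineK; last exact: integrable_fin_num fi.
pose K : R := ('C(m, c)%:R * (2 * normal_const) ^+ m)%R.
have nc0 : (0 <= 2 * normal_const :> R)%R by rewrite mulr_ge0// ltW// normal_const_gt0.
rewrite [X in _ * X = _](_ : _ = \int[mu]_x (K%:E * (ind (0 <= x)%R *
    (x * expR (- (c.+1%:R * x ^+ 2) / 2) * gauss_int x ^+ (m - c.+1).+1)%:E))); last first.
  apply: eq_integral => x _; rewrite muleCA /payoff.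
  have [x0|_] := leP 0%R x; last by rewrite !mul0e.
  rewrite ger0_norm// subnSK// !mul1e -EFinM; congr EFin.
  have -> : expR (- (c.+1%:R * x ^+ 2) / 2) = (g x ^+ c * g x)%R.
    rewrite -exprSr /g -expRM_natl; congr expR; rewrite -mulr_natl; ring.
  have -> : K = ('C(m, c)%:R * ((2 * normal_const) ^+ c * (2 * normal_const) ^+ (m - c)))%R.
    by rewrite -exprD subnKC// ltnW.
  rewrite /lim_density /normal_mass; move: (2 * normal_const)%R => a.
  by rewrite !exprMn; ring.
rewrite ge0_integralZl//; last 3 first.
- apply: emeasurable_funM; first by apply: measurable_ind; exact: measurable_fun_ler.
  apply/measurable_EFinP; apply: measurable_funM.
    apply: measurable_funM => //; apply: measurableT_comp => //.
    apply: measurable_funM => //; apply: measurableT_comp => //.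
    by apply: measurable_funM => //; exact: exprn_measurable.
  apply: measurable_funX; apply: continuous_measurable_fun.
  exact: continuous_gauss_int.
- move=> x _; have [x0|_] := leP 0%R x; last by rewrite mul0e.
  by rewrite mul1e lee_fin !mulr_ge0 ?expR_ge0 ?exprn_ge0 ?gauss_int_ge0.
- by rewrite lee_fin mulr_ge0// exprn_ge0.
rewrite gauss_by_parts subnSK// -/(face_integral m c.+1) !muleA -!EFinM.
congr (_%:E * _); rewrite /K exprS.
have := mul_bin_left m c => /(congr1 (fun n => n%:R : R)); rewrite !natrM => E.
have c0 : (c.+1%:R != 0 :> R)%R by rewrite pnatr_eq0.
rewrite (_ : 'C(m, c.+1)%:R = (m - c)%:R * 'C(m, c)%:R / c.+1%:R :> R)%R; last first.
  by rewrite -E mulrAC divff// mul1r.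
by move: c0; move: (c.+1%:R : R)%R => C C0; field.
Qed.

End gap_integral_limit.

(** * The law of the random vector and the expectation *)

Section joint_law.
Context {d : measure_display} {Omega : measurableType d} {R : realType}.
Local Notation RR := (measurableTypeR R).
Variables (P : probability Omega R) (n : nat) (xi : 'I_n -> {RV P >-> R}).

Definition joint (w : Omega) : n.-tuple RR := [tuple (xi i w : RR) | i < n].

Lemma measurable_joint : measurable_fun setT joint.
Proof.
apply/measurable_fun_tnthP => i; rewrite (_ : _ \o _ = xi i).
  exact: (measurable_funP (xi i)).
by apply/funext => w /=; rewrite tnth_mktuple.
Qed.

HB.instance Definition _ := isMeasurableFun.Build _ _ _ _ joint measurable_joint.

Lemma joint_box (A : 'I_n -> set RR) :
  (forall i, standard_normal (xi i)) -> independent_RVs xi ->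
  (forall i, measurable (A i)) ->
  distribution P joint (box A) = (\prod_j normal_prob 0 1 (A j))%E.
Proof.
move=> xi_normal xi_indep mA.
have := xi_indep [set: 'I_n]%SET A mA.
rewrite (_ : \bigcap_(i in _) _ = joint @^-1` box A).
  rewrite /distribution /pushforward => ->.
  rewrite (eq_bigl xpredT) => [|i]; last by rewrite finset.in_setT.
  by apply: eq_bigr => i _; exact: (xi_normal i (A i) (mA i)).
apply/seteqP; split => w /= h i.
  by rewrite tnth_mktuple; apply: h; rewrite /= finset.in_setT.
by move=> _; have := h i; rewrite tnth_mktuple.
Qed.

End joint_law.

Section top_gap_expectation.
Context {d : measure_display} {Omega : measurableType d} {R : realType}.
Local Notation RR := (measurableTypeR R).
Variables (P : probability Omega R) (m : nat) (xi : 'I_m.+1 -> {RV P >-> R}).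

Lemma expectation_top_gap k (eps : R) : 0 <= eps -> (k < m.+1)%N ->
  (forall i, standard_normal (xi i)) -> independent_RVs xi ->
  ('E_P[fun w => (max_abs xi w * \1_(top_gap_event xi k.+1 eps) w)%R] =
   m.+1%:R%:E * gap_integral m k eps)%E.
Proof.
move=> e0 km xi_normal xi_indep; rewrite unlock.
rewrite -(@gap_payoff_integral _ m k eps (distribution P (joint xi)))//; last first.
  by move=> A mA; exact: joint_box.
rewrite ge0_integral_pushforward//; last 2 first.
- exact: measurable_gap_payoff.
- move=> y _; apply: le_trans (gap_payoff_ge _ _ _).
  by apply: sume_ge0 => i _; exact: peak_payoff_ge0.
rewrite preimage_setT; apply: eq_integral => w _ /=.
have E : tnth (joint xi w) = (fun i => xi i w : R).
  by apply/funext => i; rewrite tnth_mktuple.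
rewrite /gap_payoff E EFinM; congr (_%:E * _%:E)%E.
rewrite indicE; congr ((nat_of_bool _)%:R).
rewrite -(@top_gap_le _ m (fun i => `|xi i w|))//.
by apply/idP/idP; rewrite inE.
Qed.

End top_gap_expectation.

Unset Implicit Arguments.
Set Strict Implicit.

Theorem theorem4p7 (R : realType) (n k : nat) (hk : (1 <= k)%N) (hkn : (k < n)%N)
    (d : measure_display) (Omega : measurableType d) (P : probability Omega R)
    (xi : 'I_n -> {RV P >-> R})
    (xi_normal : forall i, standard_normal (xi i))
    (xi_indep : independent_RVs xi) :
  let F (eps : R) : \bar R :=
    ((eps ^ (1 - k%:Z))%:E *
     'E_P[fun w => (max_abs xi w * \1_(top_gap_event xi k eps) w)%R])%E in
  cvg (F eps @[eps --> 0^'+]) /\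
  (intrinsic_volume k (cross_polytope R n))%:E =
    (((2 * pi) `^ (k%:R / 2) / k`!%:R)%R%:E * lim (F eps @[eps --> 0^'+]))%E.
Proof.
move=> F; case: n hkn xi xi_normal xi_indep @F => // m hkm xi xi_normal xi_indep F.
(* With [k.+1] in place of [k], the exponent [1 - k] becomes [- k], and the faces have dimension
   [k.+1]. *)
case: k hk hkm @F => // k _ hkm F.
have FL : F eps @[eps --> 0^'+] --> (m.+1%:R%:E * (@gap_limit R m k)%:E)%E.
  have : (m.+1%:R%:E * ((eps ^- k)%:E * gap_integral m k eps))%E @[eps --> 0^'+] -->
      (m.+1%:R%:E * (@gap_limit R m k)%:E)%E.
    by apply: cvgeZl => //; exact: gap_integral_cvg.
  apply: cvg_trans; apply: near_eq_cvg; near=> e.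
  have e0 : 0 < e by near: e; exact: nbhs_right_gt.
  rewrite /F expectation_top_gap ?(ltW e0) ?(ltnW hkm)// muleCA; congr (_ * (_%:E * _))%E.
  by rewrite -addn1 PoszD opprD addrCA subrr addr0 -exprnN.
split; first by apply/cvg_ex; eexists; exact: FL.
rewrite (cvg_lim _ FL)//.
rewrite intrinsic_volume_cross_polytope -1?ltnS// gap_limitE// !muleA -!EFinM.
(* Both sides are multiples of [face_integral m k.+1]; only the constants remain to be compared. *)
congr (_%:E * _)%E.
rewrite /region_const /normal_const.
have p0 : 0 < 2 * pi :> R by rewrite mulr_gt0// pi_gt0.
(* All powers of [2 * pi] are natural powers of its square root [s], which reduces the comparison to
   an identity of rational functions. *)
have [s s0 sE] : exists2 s : R, 0 < s & forall j : nat, (2 * pi) `^ (j%:R / 2) = s ^+ j.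
  exists (Num.sqrt (2 * pi)); first by rewrite sqrtr_gt0.
  move=> j; rewrite -powR12_sqrt ?ltW// -powR_mulrn ?powR_ge0// -powRrM.
  by rewrite (mulrC 2^-1).
have -> : Num.sqrt (2 * pi) = s.
  by have := sE 1%N; rewrite expr1 mul1r => <-; rewrite powR12_sqrt ?ltW.
rewrite powRN !sE expr1n mul1r.
have -> : (2 * s^-1) ^+ m.+1 = 2 ^+ m.+1 / (s ^+ k.+1 * s ^+ (m.+1 - k.+1)).
  by rewrite exprMn exprVn -exprD subnKC// ltnW.
have f0 : k.+1`!%:R != 0 :> R by rewrite pnatr_eq0 -lt0n fact_gt0.
have sk : s ^+ k.+1 != 0 by rewrite expf_neq0 ?gt_eqF.
have sj : s ^+ (m.+1 - k.+1) != 0 by rewrite expf_neq0 ?gt_eqF.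
rewrite [2 ^+ m.+1]exprS.
move: f0 sk sj; move: (k.+1`!%:R : R) (s ^+ k.+1) (s ^+ (m.+1 - k.+1)) => f a b f0 a0 b0.
by field; rewrite f0 a0 b0.
Unshelve. all: by end_near. Qed.
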